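(* Let $G$ be a discrete group and let $H\le G$ be an amenable nontrivial subgroup of infinite index. Let $\mathbb{Z}_2\wr_{G/H}G=\left(\bigoplus_{G/H}\mathbb{Z}_2\right)\rtimes G$. Then there exists a primitive ideal $I$ of $C^*_r(\mathbb{Z}_2\wr_{G/H}G)$ that is not induced from $C^*\left(\bigoplus_{G/H}\mathbb{Z}_2\right)$; that is, writing $N=\bigoplus_{G/H}\mathbb{Z}_2$, there is no ideal $J$ of $C^*(N)$ with $I=\mathrm{Ind}_N(J)$.
   Context: ''Ideal'' means closed two-sided ideal; a primitive ideal is the kernel of a nonzero irreducible representation. $\mathbb{Z}_2=\mathbb{Z}/2\mathbb{Z}$, and in the wreath product $G$ acts on $\bigoplus_{G/H}\mathbb{Z}_2$ by permuting coordinates via the canonical left action on $G/H$. For a subgroup $N$ of a discrete group $K$, $P_N\colon C^*_r(K)\to C^*_r(N)$ is the canonical conditional expectation, determined by $P_N(\lambda_k)=\lambda_k$ if $k\in N$ and $P_N(\lambda_k)=0$ otherwise; for an ideal $J$ of $C^*_r(N)$, $\mathrm{Ind}_N(J)=\{b\in C^*_r(K): P_N(xby)\in J\text{ for all }x,y\in C^*_r(K)\}$. Here $K=\mathbb{Z}_2\wr_{G/H}G$, and $C^*(N)=C^*_r(N)$ since $N$ is abelian. *)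

(* Defs.v *)
From HB Require Import structures.
From mathcomp Require Import all_boot all_order all_algebra.
From mathcomp Require Import sesquilinear complex finmap ring lra.
From mathcomp Require Import all_classical all_reals all_analysis.

Set Implicit Arguments.
Unset Strict Implicit.
Unset Printing Implicit Defensive.

Import Order.TTheory GRing.Theory Num.Theory.
Import numFieldNormedType.Exports.

Local Open Scope classical_set_scope.
Local Open Scope ring_scope.

Local Notation normc := ComplexField.Normc.normc.

(* The inner product is linear in its first argument. *)
HB.mixin Record CompleteNormedModule_isHilbert (R : realType) V
    & CompleteNormedModule R[i] V := {
  inner : {dot V for @Num.conj R[i]} ;
  inner_norm : forall x : V, inner x x = `|x| ^+ 2 }.

#[short(type="hilbertType")]
HB.structure Definition Hilbert (R : realType) :=
  {V of CompleteNormedModule R[i] V & CompleteNormedModule_isHilbert R V}.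

Section operators.
Variables (R : realType) (V : hilbertType R).

Definition bounded_operator (T : V -> V) := linear T /\ continuous T.

Definition adjoint_pair (T S : V -> V) :=
  forall x y, inner (T x) y = inner x (S y).

(* The bounded operators T with inf_(S in A) ||T - S|| = 0: the inequality
   below is ||T - S|| <= e for the operator norm. *)
Definition norm_closure (A : set (V -> V)) : set (V -> V) :=
  [set T | bounded_operator T /\ forall e : R, 0 < e ->
     exists2 S, A S & forall x, `|T x - S x| <= e%:C%C * `|x|].

(* Closed two-sided ideals of an operator algebra A. *)
Record is_ideal (A I : set (V -> V)) : Prop := IsIdeal {
  ideal_sub : I `<=` A ;
  ideal0 : I (fun=> 0) ;
  ideal_linear : forall c S T, I S -> I T -> I (fun x => c *: S x + T x) ;
  ideal_mull : forall a T, A a -> I T -> I (a \o T) ;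
  ideal_mulr : forall a T, A a -> I T -> I (T \o a) ;
  ideal_closed : norm_closure I `<=` I }.

End operators.

Section representations.
Variables (R : realType) (V W : hilbertType R).
Variables (A : set (V -> V)) (rho : (V -> V) -> (W -> W)).

(* *-representations of an operator *-algebra A on W; rho is unconstrained
   outside A. *)
Record is_representation : Prop := IsRepresentation {
  rep_bounded : forall a, A a -> bounded_operator (rho a) ;
  rep_linear : forall c a b, A a -> A b ->
    rho (fun x => c *: a x + b x) = (fun w => c *: rho a w + rho b w) ;
  rep_mul : forall a b, A a -> A b -> rho (a \o b) = rho a \o rho b ;
  rep_adjoint : forall a b, A a -> A b ->
    adjoint_pair a b -> adjoint_pair (rho a) (rho b) }.

Definition closed_invariant_subspace (M : set W) :=
  [/\ M 0, forall c u w, M u -> M w -> M (c *: u + w), closed M &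
      forall a w, A a -> M w -> M (rho a w)].

Definition nonzero_irreducible :=
  (exists2 a, A a & rho a <> (fun=> 0)) /\
  forall M, closed_invariant_subspace M -> M = [set 0] \/ M = [set: W].

End representations.

Definition is_primitive_ideal (R : realType) (V : hilbertType R)
    (A I : set (V -> V)) :=
  exists (W : hilbertType R) (rho : (V -> V) -> (W -> W)),
    [/\ is_representation A rho, nonzero_irreducible A rho &
        I = [set a | A a /\ rho a = (fun=> 0)]].

Section rsum.
Variables (R : realType) (T : choiceType).
Implicit Types (a b p q : T -> R).

Definition rsummable a := summable [set: T] (fun t => (a t)%:E).

(* The sum of an absolutely summable family over an arbitrary index set: sum of
   the positive parts minus sum of the negative parts. *)
Definition rsum a : R :=
  fine (\esum_(t in [set: T]) (Num.max (a t) 0)%:E) -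
  fine (\esum_(t in [set: T]) (Num.max (- a t) 0)%:E).

Lemma rsummable_le a b :
  (forall t, `|a t| <= `|b t|) -> rsummable b -> rsummable a.
Proof.
move=> ab; apply: le_lt_trans; apply: le_esum => t _.
by rewrite !abse_EFin lee_fin.
Qed.

Lemma rsummableD a b :
  rsummable a -> rsummable b -> rsummable (fun t => a t + b t).
Proof. exact: summableD. Qed.

Lemma esum_nneg a : (forall t, 0 <= a t) -> rsummable a ->
  \esum_(t in [set: T]) (a t)%:E \is a fin_num.
Proof.
move=> a0; rewrite /rsummable summableE.
by rewrite (eq_esum (b := fun t => (a t)%:E))// => t _; rewrite abse_EFin ger0_norm.
Qed.

Lemma rsumE a p q : (forall t, 0 <= p t) -> (forall t, 0 <= q t) ->
  rsummable p -> rsummable q -> (forall t, a t = p t - q t) ->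
  rsum a = fine (\esum_(t in [set: T]) (p t)%:E) -
           fine (\esum_(t in [set: T]) (q t)%:E).
Proof.
move=> p0 q0 sp sq apq.
have m0 (x : R) : 0 <= Num.max x 0 by rewrite le_max lexx orbT.
have sa : rsummable a.
  have := rsummableD sp sq; apply: rsummable_le => t.
  have := p0 t; have := q0 t; rewrite apq => ? ?.
  by rewrite [leRHS]ger0_norm ?addr_ge0// ler_norml; apply/andP; split; lra.
have sm a1 : rsummable a1 -> rsummable (fun t => Num.max (a1 t) 0).
  apply: rsummable_le => t; rewrite ger0_norm//.
  by rewrite ge_max normr_ge0 ler_norm.
have sN : rsummable (fun t => - a t).
  by apply: rsummable_le sa => t; rewrite normrN.
apply/eqP; rewrite /rsum subr_eq addrAC eq_sym subr_eq eq_sym; apply/eqP.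
rewrite -[RHS]fineD ?esum_nneg//; last exact: sm.
rewrite -fineD ?esum_nneg//; last exact: sm.
rewrite -!esumD//; try by move=> t _; rewrite lee_fin.
congr fine; apply: eq_esum => t _; rewrite -!EFinD apq; congr EFin.
by rewrite !maxEle; case: ifP; case: ifP; lra.
Qed.

Lemma rsum_ge0E a : (forall t, 0 <= a t) -> rsummable a ->
  rsum a = fine (\esum_(t in [set: T]) (a t)%:E).
Proof.
move=> a0 sa; have s0 : rsummable (fun=> 0 : R).
  by apply: rsummable_le sa => t; rewrite normr0.
rewrite (@rsumE a a (fun=> 0))//; last by move=> t; rewrite subr0.
by rewrite [X in _ - fine X]esum1//= subr0.
Qed.

Lemma rsummable_split a : rsummable a ->
  exists p q, [/\ forall t, 0 <= p t, forall t, 0 <= q t, rsummable p,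
    rsummable q & forall t, a t = p t - q t].
Proof.
move=> sa; exists (fun t => Num.max (a t) 0), (fun t => Num.max (- a t) 0); split.
- by move=> t; rewrite le_max lexx orbT.
- by move=> t; rewrite le_max lexx orbT.
- apply: rsummable_le sa => t; rewrite ger0_norm ?le_max ?lexx ?orbT//.
  by rewrite ge_max normr_ge0 ler_norm.
- apply: rsummable_le sa => t; rewrite ger0_norm ?le_max ?lexx ?orbT//.
  by rewrite ge_max normr_ge0 -normrN ler_norm.
- by move=> t; rewrite !maxEle; case: ifP; case: ifP; lra.
Qed.

Lemma rsumD a b : rsummable a -> rsummable b ->
  rsum (fun t => a t + b t) = rsum a + rsum b.
Proof.
move=> /rsummable_split[p [q [p0 q0 sp sq apq]]].
move=> /rsummable_split[p' [q' [p0' q0' sp' sq' apq']]].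
rewrite (rsumE p0 q0 sp sq apq) (rsumE p0' q0' sp' sq' apq').
rewrite (@rsumE _ (fun t => p t + p' t) (fun t => q t + q' t)).
- rewrite -addrACA -opprD; congr (_ - _).
  + by rewrite -fineD ?esum_nneg// -esumD// => t _; rewrite lee_fin.
  + by rewrite -fineD ?esum_nneg// -esumD// => t _; rewrite lee_fin.
- by move=> t; rewrite addr_ge0.
- by move=> t; rewrite addr_ge0.
- exact: rsummableD.
- exact: rsummableD.
- by move=> t; rewrite apq apq' opprD addrACA.
Qed.

Lemma esumZ_nneg c p : 0 <= c -> (forall t, 0 <= p t) ->
  (\esum_(t in [set: T]) (c * p t)%:E =
   c%:E * \esum_(t in [set: T]) (p t)%:E)%E.
Proof.
have le_ c' p' : 0 <= c' -> (forall t, 0 <= p' t) ->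
  (\esum_(t in [set: T]) (c' * p' t)%:E <=
   c'%:E * \esum_(t in [set: T]) (p' t)%:E)%E.
  move=> c0 p0; apply: ge_ereal_sup => _ [X XT] <-.
  rewrite (eq_fsbigr (fun t => c'%:E * (p' t)%:E)%E) => [|t _]; last first.
    by rewrite EFinM.
  rewrite -ge0_mule_fsumr => [|t]; last by rewrite lee_fin.
  by rewrite lee_wpmul2l ?lee_fin//; apply: ereal_sup_ubound; exists X.
move=> c0 p0; apply/eqP; rewrite eq_le le_//=.
have [->|cn0] := eqVneq c 0.
  by rewrite mul0e esum_ge0// => t _; rewrite mul0r.
have c_gt0 : 0 < c by rewrite lt_neqAle eq_sym cn0.
rewrite muleC -lee_pdivlMr// muleC.
under eq_esum => t _ do rewrite -[p t](mulKf cn0).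
by apply: le_; [rewrite invr_ge0|move=> t; rewrite mulr_ge0].
Qed.

Lemma rsummableZ c a : rsummable a -> rsummable (fun t => c * a t).
Proof.
rewrite /rsummable /summable => sa.
rewrite (eq_esum (b := fun t => (`|c| * `|a t|)%:E)) => [|t _]; last first.
  by rewrite abse_EFin normrM.
rewrite esumZ_nneg// lte_mul_pinfty//.
Qed.

Lemma rsumN a : rsummable a -> rsum (fun t => - a t) = - rsum a.
Proof.
move=> /rsummable_split[p [q [p0 q0 sp sq apq]]].
rewrite (rsumE p0 q0 sp sq apq) (@rsumE _ q p)// ?opprB// => t.
by rewrite apq opprB.
Qed.

Lemma rsumZ c a : rsummable a -> rsum (fun t => c * a t) = c * rsum a.
Proof.
move=> sa; wlog c0 : c / 0 <= c => [hw|].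
  have [/hw//|/ltW c0] := leP 0 c.
  have -> : (fun t => c * a t) = (fun t => - (- c * a t)).
    by apply/funext => t; rewrite mulNr opprK.
  by rewrite rsumN ?hw ?oppr_ge0//; [rewrite mulNr opprK|apply: rsummableZ].
have [p [q [p0 q0 sp sq apq]]] := rsummable_split sa.
rewrite (rsumE p0 q0 sp sq apq).
rewrite (@rsumE _ (fun t => c * p t) (fun t => c * q t)).
- by rewrite !esumZ_nneg// !fineM ?esum_nneg//= mulrBr.
- by move=> t; rewrite mulr_ge0.
- by move=> t; rewrite mulr_ge0.
- exact: rsummableZ.
- exact: rsummableZ.
- by move=> t; rewrite apq mulrBr.
Qed.

Lemma rsum_ge0 a : (forall t, 0 <= a t) -> rsummable a -> 0 <= rsum a.
Proof.
by move=> a0 sa; rewrite rsum_ge0E// fine_ge0// esum_ge0// => t _; rewrite lee_fin.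
Qed.

Lemma ler_rsum_fin a (X : {fset T}) : (forall t, 0 <= a t) -> rsummable a ->
  \sum_(t <- X) a t <= rsum a.
Proof.
move=> a0 sa; rewrite rsum_ge0E// -lee_fin fineK ?esum_nneg//.
rewrite esum_ge//; exists [set` X].
  by split => //; exact: finite_fset.
rewrite fsbig_finite ?finite_fset//= set_fsetK.
by rewrite -sumEFin.
Qed.

Lemma rsum_fin_le a M : (forall t, 0 <= a t) ->
  (forall X : {fset T}, \sum_(t <- X) a t <= M) -> rsummable a /\ rsum a <= M.
Proof.
move=> a0 aM; have eM : (\esum_(t in [set: T]) (a t)%:E <= M%:E)%E.
  apply: ge_ereal_sup => _ [X [finX _]] <-.
  by rewrite fsbig_finite//= sumEFin lee_fin.
have sa : rsummable a.
  rewrite /rsummable /summable.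
  rewrite (eq_esum (b := fun t => (a t)%:E)) ?(le_lt_trans eM) ?ltry// => t _.
  by rewrite abse_EFin ger0_norm.
by split => //; rewrite rsum_ge0E// -lee_fin fineK// esum_nneg.
Qed.

End rsum.

Section csum.
Variables (R : realType) (T : choiceType).
Implicit Types (f g : T -> R[i]).

Definition csummable f := rsummable (fun t => normc (f t)).

Definition csum f : R[i] :=
  (rsum (fun t => complex.Re (f t)) +i* rsum (fun t => complex.Im (f t)))%C.

Lemma normc_ge0 (z : R[i]) : 0 <= normc z.
Proof. by case: z => x y; apply: sqrtr_ge0. Qed.

Lemma sqr_normc (z : R[i]) : normc z ^+ 2 = complex.Re z ^+ 2 + complex.Im z ^+ 2.
Proof. by case: z => x y /=; rewrite sqr_sqrtr// addr_ge0// sqr_ge0. Qed.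

Lemma normr_Re_le (z : R[i]) : `|complex.Re z| <= normc z.
Proof.
rewrite -(@ler_pXn2r _ 2) ?nnegrE ?normc_ge0// sqr_normc real_normK ?num_real//.
by rewrite lerDl sqr_ge0.
Qed.

Lemma normr_Im_le (z : R[i]) : `|complex.Im z| <= normc z.
Proof.
rewrite -(@ler_pXn2r _ 2) ?nnegrE ?normc_ge0// sqr_normc real_normK ?num_real//.
by rewrite lerDr sqr_ge0.
Qed.

Lemma csummable_le f (b : T -> R) :
  (forall t, normc (f t) <= `|b t|) -> rsummable b -> csummable f.
Proof.
by move=> fb; apply: rsummable_le => t; rewrite ger0_norm ?normc_ge0.
Qed.

Lemma csummable_Re f : csummable f -> rsummable (fun t => complex.Re (f t)).
Proof.
by apply: rsummable_le => t; rewrite (ger0_norm (normc_ge0 _)) normr_Re_le.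
Qed.

Lemma csummable_Im f : csummable f -> rsummable (fun t => complex.Im (f t)).
Proof.
by apply: rsummable_le => t; rewrite (ger0_norm (normc_ge0 _)) normr_Im_le.
Qed.

Lemma csummableD f g : csummable f -> csummable g ->
  csummable (fun t => f t + g t).
Proof.
move=> sf sg; apply: csummable_le (rsummableD sf sg) => t.
by rewrite ger0_norm ?addr_ge0 ?normc_ge0// le_normcD.
Qed.

Lemma csummableZ c f : csummable f -> csummable (fun t => c * f t).
Proof.
move=> sf; apply: csummable_le (rsummableZ (normc c) sf) => t.
by rewrite ComplexField.Normc.normcM ler_norm.
Qed.

Lemma csumD f g : csummable f -> csummable g ->
  csum (fun t => f t + g t) = csum f + csum g.
Proof.
move=> sf sg; apply/eqP; rewrite eq_complex /= -!rsumD//.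
- apply/andP; split; apply/eqP; congr rsum; apply/funext => t;
    by case: (f t) => ? ?; case: (g t).
- exact: csummable_Im.
- exact: csummable_Im.
- exact: csummable_Re.
- exact: csummable_Re.
Qed.

Lemma csumZ c f : csummable f -> csum (fun t => c * f t) = c * csum f.
Proof.
case: c => x y sf.
have [sr si] := (csummable_Re sf, csummable_Im sf).
rewrite /csum; apply/eqP; rewrite eq_complex /=; apply/andP; split; apply/eqP.
- rewrite -(rsumZ x sr) -(rsumZ y si) -rsumN; last exact: rsummableZ.
  rewrite -rsumD; first by congr rsum; apply/funext => t; case: (f t).
    exact: rsummableZ.
  by rewrite /rsummable summableN; under eq_fun do rewrite /= opprK; exact: rsummableZ.
- rewrite -(rsumZ x si) -(rsumZ y sr) -rsumD; do ?[exact: rsummableZ].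
  by congr rsum; apply/funext => t; case: (f t).
Qed.

Lemma csum_conj f : csummable f -> csum (fun t => Num.conj (f t)) = Num.conj (csum f).
Proof.
move=> sf; apply/eqP; rewrite eq_complex /=; apply/andP; split; apply/eqP.
  by congr rsum; apply/funext => t; case: (f t).
rewrite -rsumN; last exact: csummable_Im.
by congr rsum; apply/funext => t; case: (f t).
Qed.

End csum.

Section ell2.
Variables (R : realType) (T : choiceType).
Implicit Types (f g : T -> R[i]).

Definition square_summable : {pred T -> R[i]} :=
  fun f => rsummable (fun t => normc (f t) ^+ 2).

Lemma square_summable0 : (fun=> 0) \in square_summable.
Proof.
rewrite unfold_in; apply: (rsummable_le (b := fun=> 0)) => [t|].
  by rewrite ComplexField.Normc.normc0 expr0n.
by rewrite /rsummable /summable esum1 ?ltry// => t _; rewrite abse0.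
Qed.

Lemma square_summableZ c f : f \in square_summable ->
  (fun t => c * f t) \in square_summable.
Proof.
rewrite !unfold_in => sf; apply: rsummable_le (rsummableZ (normc c ^+ 2) sf) => t.
by rewrite ComplexField.Normc.normcM exprMn.
Qed.

Lemma square_summableD f g : f \in square_summable -> g \in square_summable ->
  (fun t => f t + g t) \in square_summable.
Proof.
rewrite !unfold_in => sf sg.
have h := rsummableD (rsummableZ 2 sf) (rsummableZ 2 sg).
apply: rsummable_le h => t.
have := le_normcD (f t) (g t).
have := normc_ge0 (f t + g t); have := normc_ge0 (f t); have := normc_ge0 (g t).
move: (normc (f t + g t)) (normc (f t)) (normc (g t)) => w x y y0 x0 w0 wxy.
have : w ^+ 2 <= (x + y) ^+ 2 by rewrite ler_pXn2r ?nnegrE ?addr_ge0.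
have := sqr_ge0 w; have := sqr_ge0 x; have := sqr_ge0 y; have := sqr_ge0 (x - y).
move=> h1 h2 h3 h4 h5.
rewrite ger0_norm// ger0_norm; first by move: h1 h5; rewrite !expr2; nra.
by lra.
Qed.

Record ell2 := Ell2 {
  ell2_fun :> T -> R[i] ;
  ell2P : ell2_fun \in square_summable }.

HB.instance Definition _ := [isSub for ell2_fun].
HB.instance Definition _ := [Choice of ell2 by <:].

Implicit Types x y z : ell2.

Lemma ell2_eqP x y : x =1 y -> x = y.
Proof. by move=> xy; apply/val_inj/funext. Qed.

Definition ell2_zero := Ell2 square_summable0.
Definition ell2_scale c x := Ell2 (square_summableZ c (ell2P x)).
Definition ell2_add x y := Ell2 (square_summableD (ell2P x) (ell2P y)).
Definition ell2_opp x := ell2_scale (-1) x.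

Let ell2_addA : associative ell2_add.
Proof. by move=> x y z; apply: ell2_eqP => t; apply: addrA. Qed.
Let ell2_addC : commutative ell2_add.
Proof. by move=> x y; apply: ell2_eqP => t; apply: addrC. Qed.
Let ell2_add0 : left_id ell2_zero ell2_add.
Proof. by move=> x; apply: ell2_eqP => t; apply: add0r. Qed.
Let ell2_addN : left_inverse ell2_zero ell2_opp ell2_add.
Proof. by move=> x; apply: ell2_eqP => t /=; rewrite mulN1r addNr. Qed.

HB.instance Definition _ :=
  GRing.isZmodule.Build ell2 ell2_addA ell2_addC ell2_add0 ell2_addN.

Let ell2_scaleA a b x : ell2_scale a (ell2_scale b x) = ell2_scale (a * b) x.
Proof. by apply: ell2_eqP => t; apply: mulrA. Qed.
Let ell2_scale1 : left_id 1 ell2_scale.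
Proof. by move=> x; apply: ell2_eqP => t; apply: mul1r. Qed.
Let ell2_scaleDr : right_distributive ell2_scale +%R.
Proof. by move=> c x y; apply: ell2_eqP => t; apply: mulrDr. Qed.
Let ell2_scaleDl x : {morph ell2_scale^~ x : a b / a + b}.
Proof. by move=> a b; apply: ell2_eqP => t; apply: mulrDl. Qed.

HB.instance Definition _ := GRing.Zmodule_isLmodule.Build R[i] ell2
  ell2_scaleA ell2_scale1 ell2_scaleDr ell2_scaleDl.

Lemma ell2_addE x y t : (x + y) t = x t + y t.
Proof. by []. Qed.

Lemma ell2_scaleE c x t : (c *: x) t = c * x t.
Proof. by []. Qed.

Lemma ell2_oppE x t : (- x) t = - x t.
Proof. exact: mulN1r. Qed.

Lemma csummable_ell2 x y : csummable (fun t => x t * Num.conj (y t)).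
Proof.
apply: csummable_le (rsummableD (ell2P x) (ell2P y)) => t.
rewrite ger0_norm ?addr_ge0 ?sqr_ge0//.
have -> : normc (x t * Num.conj (y t)) = normc (x t) * normc (y t).
  by rewrite ComplexField.Normc.normcM; congr (_ * _); case: (y t) => a b /=; rewrite sqrrN.
have := normc_ge0 (x t); have := normc_ge0 (y t).
by move: (normc (x t)) (normc (y t)) => a b; rewrite !expr2; nra.
Qed.

Definition ell2_inner x y : R[i] := csum (fun t => x t * Num.conj (y t)).

Lemma ell2_inner_linearl y : scalar (ell2_inner^~ y).
Proof.
move=> c x x'; rewrite /ell2_inner -csumZ; last exact: csummable_ell2.
rewrite -csumD; last exact: csummable_ell2; last first.
  by apply: csummableZ; exact: csummable_ell2.
by congr csum; apply/funext => t; rewrite ell2_addE ell2_scaleE mulrDl mulrA.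
Qed.

Lemma ell2_innerC x y : ell2_inner x y = (-1) ^+ false * Num.conj (ell2_inner y x).
Proof.
rewrite expr0 mul1r -csum_conj; last exact: csummable_ell2.
by congr csum; apply/funext => t; rewrite rmorphM /= conjCK mulrC.
Qed.

Lemma ell2_inner_linearr x : linear_for (Num.conj \; *%R) (ell2_inner x).
Proof.
move=> c y y'; rewrite /= !(ell2_innerC x) !expr0 !mul1r.
by rewrite ell2_inner_linearl rmorphD rmorphM.
Qed.

Lemma ell2_innerxx x : ell2_inner x x = (rsum (fun t => normc (x t) ^+ 2))%:C%C.
Proof.
apply/eqP; rewrite eq_complex /=; apply/andP; split; apply/eqP.
  by congr rsum; apply/funext => t; rewrite sqr_normc; case: (x t) => a b /=; ring.
rewrite (_ : (fun _ => _) = (fun t => 0 * normc (x t) ^+ 2)); last first.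
  by apply/funext => t; case: (x t) => a b /=; ring.
by rewrite rsumZ ?mul0r//; exact: ell2P.
Qed.

Lemma ell2_inner_gt0 x : x != 0 -> 0 < ell2_inner x x.
Proof.
move=> xn0; rewrite ell2_innerxx ltcR.
have [t xt] : exists t, x t != 0.
  apply: contrapT => /forallNP x0; move/eqP : xn0; apply; apply: ell2_eqP => t.
  by move/negP : (x0 t); rewrite negbK => /eqP ->.
have := ler_rsum_fin [fset t]%fset (fun t => sqr_ge0 (normc (x t))) (ell2P x).
rewrite big_seq_fset1; apply: lt_le_trans.
rewrite exprn_gt0// lt_neqAle normc_ge0 andbT eq_sym.
by apply: contra xt => /eqP/ComplexField.Normc.eq0_normc ->.
Qed.

HB.instance Definition _ := bilinear_isBilinear.Build R[i] ell2 ell2 R[i]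
  *%R (Num.conj \; *%R) ell2_inner (ell2_inner_linearl, ell2_inner_linearr).
HB.instance Definition _ := isHermitianSesquilinear.Build
  R[i] ell2 false (@Num.conj R[i]) ell2_inner ell2_innerC.
HB.instance Definition _ := isDotProduct.Build R[i] ell2 ell2_inner ell2_inner_gt0.
End ell2.

Section dot_norm.
Variables (C : numClosedFieldType) (U : lmodType C).
Variable form : {dot U for @Num.conj C}.

Lemma dot_CauchySchwarz u v : `|form u v| ^+ 2 <= form u u * form v v.
Proof.
have [->|v0] := eqVneq v 0; first by rewrite !linear0r normr0 expr0n.
have vv : 0 < form v v by exact: neq0_dnorm_gt0.
have vn0 : form v v != 0 by rewrite gt_eqF.
set a := form u v / form v v.
have := dnorm_ge0 form (u - a *: v).
rewrite dnormB dnormZ linearZr_LR /=.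
have vr : Num.conj (form v v) = form v v by apply/CrealP/gtr0_real.
have aE : Num.conj a * form u v = `|form u v| ^+ 2 / form v v.
  by rewrite /a rmorphM fmorphV /= vr normCK mulrAC [X in X / _]mulrC.
have aR : Num.conj (`|form u v| ^+ 2 / form v v) = `|form u v| ^+ 2 / form v v.
  by apply/CrealP/ger0_real; rewrite mulr_ge0 ?invr_ge0 ?exprn_ge0// ltW.
rewrite aE aR /a normrM normfV (gtr0_norm vv).
have -> : (`|form u v| / form v v) ^+ 2 * form v v = `|form u v| ^+ 2 / form v v.
  by field.
by rewrite opprD addrA addrK subr_ge0 ler_pdivrMr.
Qed.

Definition dot_norm u : C := sqrtC (form u u).

Lemma dot_normD u v : dot_norm (u + v) <= dot_norm u + dot_norm v.
Proof.
have n0 w : 0 <= dot_norm w by rewrite sqrtC_ge0 dnorm_ge0.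
rewrite -(@ler_pXn2r _ 2) ?nnegrE ?addr_ge0// sqrrD !sqrtCK.
rewrite dnormD -[leRHS]addrAC lerD2l.
have cs : `|form u v| <= dot_norm u * dot_norm v.
  rewrite -(@ler_pXn2r _ 2) ?nnegrE ?mulr_ge0// exprMn !sqrtCK.
  exact: dot_CauchySchwarz.
apply: (@le_trans _ _ (`|form u v| *+ 2)); last by rewrite lerMn2r cs orbT.
rewrite mulr2n; apply: real_ler_normlW; last first.
  by apply: (le_trans (ler_normD _ _)); rewrite norm_conjC.
by apply/CrealP; rewrite rmorphD /= conjCK addrC.
Qed.

Lemma dot_normZ a u : dot_norm (a *: u) = `|a| * dot_norm u.
Proof.
rewrite /dot_norm dnormZ sqrtCM ?nnegrE ?exprn_ge0// ?dnorm_ge0//.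
by rewrite sqrCK.
Qed.

Lemma dot_norm_eq0 u : dot_norm u = 0 -> u = 0.
Proof. by move/eqP; rewrite sqrtC_eq0 dnorm_eq0 => /eqP. Qed.

End dot_norm.

Section ell2_normed.
Variables (R : realType) (T : choiceType).

HB.instance Definition _ := Lmodule_isNormed.Build R[i] (ell2 R T)
  (@dot_normD _ _ (@ell2_inner R T)) (@dot_normZ _ _ (@ell2_inner R T))
  (@dot_norm_eq0 _ _ (@ell2_inner R T)).

Implicit Types x y : ell2 R T.

Lemma ell2_norm_sqr x : `|x| ^+ 2 = ell2_inner x x.
Proof. exact: sqrtCK. Qed.

Lemma ell2_norm_le x (e : R) : 0 <= e ->
  (`|x| <= e%:C%C) = (rsum (fun t => normc (x t) ^+ 2) <= e ^+ 2).
Proof.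
move=> e0; rewrite -(@ler_pXn2r _ 2) ?nnegrE ?normr_ge0 ?ler0c//.
by rewrite ell2_norm_sqr ell2_innerxx -rmorphXn lecR.
Qed.

Lemma ell2_coord_le x t (e : R) : 0 <= e -> `|x| <= e%:C%C -> normc (x t) <= e.
Proof.
move=> e0; rewrite ell2_norm_le// => xe.
rewrite -(@ler_pXn2r _ 2) ?nnegrE ?normc_ge0//; apply: le_trans xe.
have := ler_rsum_fin [fset t]%fset (fun t => sqr_ge0 (normc (x t))) (ell2P x).
by rewrite big_seq_fset1.
Qed.

Lemma ell2_complete (F : set_system (ell2 R T)) :
  ProperFilter F -> cauchy F -> cvg F.
Proof.
move=> FF /cauchy_ballP Fc.
have Fcauchy (e : R) : 0 < e -> exists2 A, F A &
    forall x y, A x -> A y -> `|x - y| <= e%:C%C.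
  move=> e0; have := Fc (e / 2)%:C%C; rewrite ltcR divr_gt0// => /(_ isT).
  move=> [[A B] /= [FA FB] AB]; exists (A `&` B); first exact: filterI.
  move=> x y [Ax _] [_ By].
  have /= := AB (x, y) (conj Ax By); rewrite -ball_normE /ball_ /=.
  move=> /ltW/le_trans; apply; rewrite lecR; lra.
have cvgRe t : cvg ((fun x : ell2 R T => complex.Re (x t)) @ F).
  apply/cauchy_cvgP/cauchy_ballP => e e0.
  have e2 : 0 < e / 2 by rewrite divr_gt0.
  have [A FA Ae] := Fcauchy (e / 2) e2.
  pose f (x : ell2 R T) := complex.Re (x t).
  have fFA : F (f @^-1` (f @` A)) by apply: filterS FA => x Ax; exists x.
  exists (f @` A, f @` A); first by split.
  move=> [_ _] [/= [x Ax <-] [y Ay <-]].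
  rewrite -ball_normE /ball_ /f /=.
  have := ell2_coord_le t (ltW e2) (Ae _ _ Ax Ay).
  have := normr_Re_le ((x - y) t).
  rewrite ell2_addE ell2_oppE; case: (x t) => a b; case: (y t) => c d /=.
  move=> h1 h2; apply: (le_lt_trans (le_trans h1 h2)); lra.
have cvgIm t : cvg ((fun x : ell2 R T => complex.Im (x t)) @ F).
  apply/cauchy_cvgP/cauchy_ballP => e e0.
  have e2 : 0 < e / 2 by rewrite divr_gt0.
  have [A FA Ae] := Fcauchy (e / 2) e2.
  pose f (x : ell2 R T) := complex.Im (x t).
  have fFA : F (f @^-1` (f @` A)) by apply: filterS FA => x Ax; exists x.
  exists (f @` A, f @` A); first by split.
  move=> [_ _] [/= [x Ax <-] [y Ay <-]].
  rewrite -ball_normE /ball_ /f /=.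
  have := ell2_coord_le t (ltW e2) (Ae _ _ Ax Ay).
  have := normr_Im_le ((x - y) t).
  rewrite ell2_addE ell2_oppE; case: (x t) => a b; case: (y t) => c d /=.
  move=> h1 h2; apply: (le_lt_trans (le_trans h1 h2)); lra.
pose l t : R[i] := (lim ((fun x : ell2 R T => complex.Re (x t)) @ F) +i*
          lim ((fun x : ell2 R T => complex.Im (x t)) @ F))%C.
have lP (e : R) A x : 0 < e -> F A ->
    (forall x y, A x -> A y -> `|x - y| <= e%:C%C) -> A x ->
    rsummable (fun t => normc (x t - l t) ^+ 2) /\
    rsum (fun t => normc (x t - l t) ^+ 2) <= e ^+ 2.
  move=> e0 FA Ae Ax; apply: rsum_fin_le => [t|X]; first exact: sqr_ge0.
  have cv : (fun y : ell2 R T => \sum_(t <- X)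
      ((complex.Re (x t) - complex.Re (y t)) ^+ 2 +
       (complex.Im (x t) - complex.Im (y t)) ^+ 2)) @ F -->
      \sum_(t <- X) normc (x t - l t) ^+ 2.
    have -> : \sum_(t <- X) normc (x t - l t) ^+ 2 = \sum_(t <- X)
      ((complex.Re (x t) - complex.Re (l t)) ^+ 2 +
       (complex.Im (x t) - complex.Im (l t)) ^+ 2).
      by apply: eq_bigr => t _; rewrite sqr_normc; case: (x t).
    apply: cvg_big => [|t _]; first exact: add_continuous.
    have hr : (fun y : ell2 R T => complex.Re (x t) - complex.Re (y t)) @ F -->
        complex.Re (x t) - complex.Re (l t).
      by apply: cvgB; [exact: cvg_cst|exact: cvgRe].
    have hi : (fun y : ell2 R T => complex.Im (x t) - complex.Im (y t)) @ F -->
        complex.Im (x t) - complex.Im (l t).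
      by apply: cvgB; [exact: cvg_cst|exact: cvgIm].
    exact: (cvgD (cvgM hr hr) (cvgM hi hi)).
  apply: (cvgr_to_le cv); apply: filterS FA => y Ay.
  have := Ae _ _ Ax Ay; rewrite (ell2_norm_le _ (ltW e0)); apply: le_trans.
  have := ler_rsum_fin X (fun t => sqr_ge0 (normc ((x - y) t))) (ell2P (x - y)).
  apply: le_trans; rewrite le_eqVlt; apply/orP; left; apply/eqP.
  apply: eq_bigr => t _; rewrite sqr_normc ell2_addE ell2_oppE.
  by case: (x t) => ? ?; case: (y t).
have [A1 FA1 A1e] := Fcauchy 1 ltr01.
have [x1 A1x1] := filter_ex FA1.
have [s1 _] := lP _ _ _ ltr01 FA1 A1e A1x1.
have ls : l \in @square_summable R T.
  have := square_summableD (ell2P x1) (square_summableZ (-1) s1).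
  rewrite (_ : (fun _ => _) = l)//; apply/funext => t.
  by rewrite mulN1r opprB addrCA subrr addr0.
apply/cvg_ex; exists (Ell2 ls); apply/cvgrPdist_le => /= e e0.
have -> : e = (complex.Re e)%:C%C.
  by case: e e0 => a b; rewrite ltcE /= => /andP[/eqP ->].
have {e0} : 0 < complex.Re e by move: e0; rewrite ltcE => /andP[].
move: (complex.Re e) => {}e e0.
have [A FA Ae] := Fcauchy e e0.
apply: (filterS _ FA) => x Ax; rewrite distrC (ell2_norm_le _ (ltW e0)).
have [_] := lP _ _ _ e0 FA Ae Ax; congr (_ <= _); congr rsum.
by apply/funext => t; rewrite ell2_addE ell2_oppE.
Qed.

HB.instance Definition _ := Uniform_isComplete.Build (ell2 R T) ell2_complete.

HB.instance Definition _ := CompleteNormedModule_isHilbert.Build R (ell2 R T)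
  (fun x => esym (ell2_norm_sqr x)).

End ell2_normed.

Section ell2_maps.
Variables (R : realType).

Lemma ler_rsum_uniq (T : choiceType) (a : T -> R) (s : seq T) :
  uniq s -> (forall t, 0 <= a t) -> rsummable a ->
  \sum_(t <- s) a t <= rsum a.
Proof.
move=> us a0 sa; have := ler_rsum_fin [fset t in s]%fset a0 sa.
apply: le_trans; rewrite le_eqVlt; apply/orP; left; apply/eqP/perm_big.
by apply: uniq_perm => // t; rewrite !inE.
Qed.

Lemma square_summable_comp (T U : choiceType) (h : U -> T) (f : T -> R[i]) :
  injective h -> f \in @square_summable R T -> (f \o h) \in @square_summable R U.
Proof.
move=> hinj sf; pose a t := normc (f t) ^+ 2.
have a0 t : 0 <= a t by exact: sqr_ge0.
have [] // := @rsum_fin_le R U (a \o h) (rsum a) => [u|X]; first exact: a0.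
rewrite -[leLHS](big_map h xpredT a); apply: ler_rsum_uniq => //.
by rewrite map_inj_uniq.
Qed.

Definition ell2_comp (T U : choiceType) (h : U -> T) (hinj : injective h)
    (x : ell2 R T) : ell2 R U :=
  Ell2 (square_summable_comp hinj (ell2P x)).

Lemma square_summable_extend (T : choiceType) (P : pred T) (U : subChoiceType P)
    (x : ell2 R U) :
  (fun t => oapp x 0 (insub t)) \in @square_summable R T.
Proof.
pose a u := normc (x u) ^+ 2; have a0 u : 0 <= a u by exact: sqr_ge0.
have [] // := @rsum_fin_le R T (fun t => normc (oapp x 0 (insub t)) ^+ 2) (rsum a).
  by move=> t; exact: sqr_ge0.
move=> X; apply: (@le_trans _ _ (\sum_(u <- pmap insub X) a u)); last first.
  apply: ler_rsum_uniq => //; last exact: (ell2P x).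
  by apply: (pmap_uniq (@insubK _ P U)).
pose ins (t : T) : option U := insub t.
have key s : \sum_(t <- s) normc (oapp x 0 (ins t)) ^+ 2 =
             \sum_(u <- pmap ins s) a u.
  elim: s => [|t s ih]; first by rewrite !big_nil.
  rewrite big_cons ih.
  have -> : pmap ins (t :: s) = oapp (cons^~ (pmap ins s)) (pmap ins s) (ins t) by [].
  case: (ins t) => [u|] /=.
    by rewrite big_cons.
  rewrite -[X in X ^+ 2 + _]/(normc (0 : R[i])).
  by rewrite ComplexField.Normc.normc0 expr0n add0r.
by rewrite -key.
Qed.

(* Extension by zero along the inclusion U -> T. *)
Definition ell2_extend (T : choiceType) (P : pred T) (U : subChoiceType P)
  (x : ell2 R U) : ell2 R T := Ell2 (square_summable_extend x).

End ell2_maps.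

Section subgroups.
Variables (G : groupType) (H : groupClosed G).

Definition subgroup := {g : G | g \in H}.

Lemma subgroup_closed : group_closed H.
Proof. by split; [exact: gpred1|move=> x y xH yH; exact: gpredF]. Qed.

HB.instance Definition _ := SubChoice.on subgroup.
HB.instance Definition _ :=
  SubChoice_isSubGroup.Build G (mem H) subgroup subgroup_closed.

Definition left_coset_rel (x y : G) := (x^-1 * y)%g \in H.

Lemma left_coset_equiv : equiv_class_of left_coset_rel.
Proof.
split=> [x|x y|y x z]; rewrite /left_coset_rel.
- by rewrite mulVg gpred1.
- by apply/idP/idP => /gpredVr; rewrite invgM invgK.
- by move=> xy yz; rewrite -(mulgK y x^-1%g) -mulgA gpredM.
Qed.

Canonical left_coset_equiv_rel := EquivRelPack left_coset_equiv.

Definition coset_space := {eq_quot left_coset_equiv_rel}%qT.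
HB.instance Definition _ := Choice.on coset_space.
HB.instance Definition _ := EqQuotient.on coset_space.

Definition coset (x : G) : coset_space := \pi_coset_space%qT x.

Lemma coset_eqP x y : reflect (coset x = coset y) ((x^-1 * y)%g \in H).
Proof. exact: (@eqquotP _ _ coset_space). Qed.

Lemma coset_repr (q : coset_space) : coset (repr q) = q.
Proof. exact: reprK. Qed.

Definition coset_act (g : G) (q : coset_space) : coset_space :=
  coset (g * repr q)%g.

Lemma coset_actE g x : coset_act g (coset x) = coset (g * x)%g.
Proof.
apply/coset_eqP; rewrite invgM -mulgA mulKg.
by apply/coset_eqP; rewrite coset_repr.
Qed.

Lemma coset_act1 q : coset_act 1%g q = q.
Proof. by rewrite /coset_act mul1g coset_repr. Qed.

Lemma coset_actM g h q : coset_act (g * h)%g q = coset_act g (coset_act h q).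
Proof. by rewrite -[coset_act h q]/(coset _) coset_actE mulgA. Qed.

End subgroups.

Section wreath.
Variables (G : groupType) (H : groupClosed G).

Local Notation X := (coset_space H).

Definition finitely_supported (f : X -> 'Z_2) := finite_set [set q | f q != 0].

(* The direct sum of copies of Z/2Z indexed by G/H. *)
Record lamps := Lamps {
  lamps_fun :> X -> 'Z_2 ;
  lampsP : `[< finitely_supported lamps_fun >] }.

HB.instance Definition _ := [isSub for lamps_fun].
HB.instance Definition _ := [Choice of lamps by <:].

Lemma lamps_eqP (f g : lamps) : f =1 g -> f = g.
Proof. by move=> fg; apply/val_inj/funext. Qed.

Lemma lamps0_subproof : `[< finitely_supported (fun=> 0) >].
Proof.
apply/asboolP; rewrite /finitely_supported.
by rewrite (_ : [set _ | _] = set0)// -subset0 => q /eqP.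
Qed.

Lemma lampsD_subproof (f g : lamps) :
  `[< finitely_supported (fun q => f q + g q) >].
Proof.
apply/asboolP; have /asboolP ff := lampsP f; have /asboolP fg := lampsP g.
apply: (@sub_finite_set _ _ ([set q | f q != 0] `|` [set q | g q != 0])).
  move=> q /= fgq; apply: contrapT => /not_orP[/negP + /negP].
  by rewrite !negbK => /eqP f0 /eqP g0; move: fgq; rewrite f0 g0 addr0 eqxx.
by rewrite finite_setU.
Qed.

Lemma lampsN_subproof (f : lamps) : `[< finitely_supported (fun q => - f q) >].
Proof.
apply/asboolP; have /asboolP ff := lampsP f.
by apply: sub_finite_set ff => q /=; rewrite oppr_eq0.
Qed.

Definition lamps_zero := Lamps lamps0_subproof.
Definition lamps_add (f g : lamps) := Lamps (lampsD_subproof f g).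
Definition lamps_opp (f : lamps) := Lamps (lampsN_subproof f).

Let lamps_addA : associative lamps_add.
Proof. by move=> f g h; apply: lamps_eqP => q /=; rewrite addrA. Qed.
Let lamps_addC : commutative lamps_add.
Proof. by move=> f g; apply: lamps_eqP => q /=; rewrite addrC. Qed.
Let lamps_add0 : left_id lamps_zero lamps_add.
Proof. by move=> f; apply: lamps_eqP => q /=; rewrite add0r. Qed.
Let lamps_addN : left_inverse lamps_zero lamps_opp lamps_add.
Proof. by move=> f; apply: lamps_eqP => q /=; rewrite addNr. Qed.

HB.instance Definition _ :=
  GRing.isZmodule.Build lamps lamps_addA lamps_addC lamps_add0 lamps_addN.

Lemma lamps_addE (f g : lamps) q : (f + g) q = f q + g q.
Proof. by []. Qed.

Lemma lampsJ_subproof (g : G) (f : lamps) :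
  `[< finitely_supported (fun q => f (coset_act g^-1%g q)) >].
Proof.
apply/asboolP; have /asboolP ff := lampsP f.
apply: (@sub_finite_set _ _ (coset_act g @` [set q | f q != 0])).
  move=> q /= fq; exists (coset_act g^-1%g q) => //.
  by rewrite -coset_actM mulgV coset_act1.
exact: finite_image.
Qed.

Definition lamps_act (g : G) (f : lamps) : lamps := Lamps (lampsJ_subproof g f).

Lemma lamps_act1 f : lamps_act 1%g f = f.
Proof. by apply: lamps_eqP => q /=; rewrite invg1 coset_act1. Qed.

Lemma lamps_actM g h f : lamps_act (g * h)%g f = lamps_act g (lamps_act h f).
Proof. by apply: lamps_eqP => q /=; rewrite invgM coset_actM. Qed.

Lemma lamps_actD g (f f' : lamps) :
  lamps_act g (f + f') = lamps_act g f + lamps_act g f'.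
Proof. exact: lamps_eqP. Qed.

Lemma lamps_actN g (f : lamps) : lamps_act g (- f) = - lamps_act g f.
Proof. exact: lamps_eqP. Qed.

Lemma lamps_act0 g : lamps_act g 0 = 0.
Proof. exact: lamps_eqP. Qed.

(* The semidirect product lamps ><| G. *)
Record wreath := Wreath { wreath_lamps : lamps ; wreath_base : G }.

Definition wreath_pair (k : wreath) := (wreath_lamps k, wreath_base k).
Definition pair_wreath (p : lamps * G) := Wreath p.1 p.2.

Lemma wreath_pairK : cancel wreath_pair pair_wreath.
Proof. by case. Qed.

HB.instance Definition _ := Choice.copy wreath (can_type wreath_pairK).

Definition wreath_one := Wreath 0 1%g.

Definition wreath_mul (k l : wreath) := Wreath
  (wreath_lamps k + lamps_act (wreath_base k) (wreath_lamps l))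
  (wreath_base k * wreath_base l)%g.

Definition wreath_inv (k : wreath) := Wreath
  (- lamps_act (wreath_base k)^-1%g (wreath_lamps k)) (wreath_base k)^-1%g.

Let wreath_mulA : associative wreath_mul.
Proof.
move=> [f g] [f' g'] [f'' g'']; rewrite /wreath_mul /= mulgA; congr Wreath.
by rewrite lamps_actD lamps_actM addrA.
Qed.

Let wreath_mul1 : left_id wreath_one wreath_mul.
Proof. by move=> [f g]; rewrite /wreath_mul /= mul1g lamps_act1 add0r. Qed.

Let wreath_1mul : right_id wreath_one wreath_mul.
Proof. by move=> [f g]; rewrite /wreath_mul /= mulg1 lamps_act0 addr0. Qed.

Let wreath_mulV : left_inverse wreath_one wreath_inv wreath_mul.
Proof. by move=> [f g]; rewrite /wreath_mul /= mulVg addNr. Qed.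

Let wreath_Vmul : right_inverse wreath_one wreath_inv wreath_mul.
Proof.
move=> [f g]; rewrite /wreath_mul /= mulgV.
by rewrite lamps_actN -lamps_actM mulgV lamps_act1 addrN.
Qed.

HB.instance Definition _ := isGroup.Build wreath
  wreath_mulA wreath_mul1 wreath_1mul wreath_mulV wreath_Vmul.

(* The direct sum, as a subgroup of the wreath product. *)
Definition lamp_group : {pred wreath} := [pred k | wreath_base k == 1%g].

Let lamp_groupM : mulg_closed lamp_group.
Proof. by move=> k l; rewrite !inE /= => /eqP-> /eqP->; rewrite mulg1. Qed.
Let lamp_group1 : 1%g \in lamp_group.
Proof. by rewrite inE /=. Qed.
Let lamp_groupV : invg_closed lamp_group.
Proof. by move=> k; rewrite !inE /= => /eqP->; rewrite invg1. Qed.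

HB.instance Definition _ := isMulClosed.Build wreath lamp_group lamp_groupM.
HB.instance Definition _ := isMul1Closed.Build wreath lamp_group lamp_group1.
HB.instance Definition _ := isInvClosed.Build wreath lamp_group lamp_groupV.

End wreath.

Arguments lamp_group {G} H _.

(* Existence of a left-invariant mean on the bounded real functions on G; the
   values of m at unbounded functions are irrelevant. *)
Definition amenable (R : realType) (G : groupType) :=
  exists m : (G -> R) -> R,
  [/\ forall (c : R) (f g : G -> R), bounded_fun f -> bounded_fun g ->
        m (fun x => c * f x + g x) = c * m f + m g,
      forall f : G -> R, bounded_fun f -> (forall x, 0 <= f x) -> 0 <= m f,
      m (fun=> 1) = 1 &
      forall (g : G) (f : G -> R), bounded_fun f ->
        m (fun x => f (g^-1 * x)%g) = m f].

Section reduced_group_algebra.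
Variables (R : realType) (K : groupType).

Lemma translation_inj (k : K) : injective (fun t => k^-1 * t)%g.
Proof. exact: mulgI. Qed.

Definition lambda (k : K) : ell2 R K -> ell2 R K :=
  ell2_comp (@translation_inj k).

Lemma lambdaE k x t : lambda k x t = x (k^-1 * t)%g.
Proof. by []. Qed.

Definition group_algebra_operators : set (ell2 R K -> ell2 R K) :=
  [set T | exists (s : seq K) (c : K -> R[i]),
     T = fun x => \sum_(k <- s) c k *: lambda k x].

Definition reduced_algebra : set (ell2 R K -> ell2 R K) :=
  norm_closure group_algebra_operators.

Variable N : groupClosed K.

(* C*_r(N) acts on ell2(N). The conditional expectation is the compression
   a |-> V^* a V by the inclusion V : ell2(N) -> ell2(K), that is, extend by
   zero, apply a, restrict; expectation_lambda and expectation_lambda0 give its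
   values at the generators. *)
Definition expectation (a : ell2 R K -> ell2 R K) :
    ell2 R (subgroup N) -> ell2 R (subgroup N) :=
  fun x => ell2_comp (@val_inj _ _ (subgroup N)) (a (ell2_extend x)).

End reduced_group_algebra.

Arguments reduced_algebra R K : clear implicits.
Arguments lambda R {K} k.
Arguments expectation {R K} N a.

Lemma ell2_extend_val (R : realType) (T : choiceType) (P : pred T)
    (U : subChoiceType P) (x : ell2 R U) u : ell2_extend x (val u) = x u.
Proof. by rewrite /= valK. Qed.

Lemma ell2_extend_notin (R : realType) (T : choiceType) (P : pred T)
    (U : subChoiceType P) (x : ell2 R U) t : ~~ P t -> ell2_extend x t = 0.
Proof. by move=> Pt; rewrite /= insubN. Qed.

Lemma expectation_lambda (R : realType) (K : groupType) (N : groupClosed K)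
    (k : subgroup N) :
  expectation N (lambda R (val k)) = lambda R k.
Proof.
apply/funext => x; apply: ell2_eqP => t.
have vE : ((val k)^-1 * val t)%g = val (k^-1 * t)%g by rewrite valM gmulfV.
by rewrite -[LHS]/(ell2_extend x ((val k)^-1 * val t)%g) vE ell2_extend_val.
Qed.

Lemma expectation_lambda0 (R : realType) (K : groupType) (N : groupClosed K)
    (k : K) : k \notin N -> expectation N (lambda R k) = (fun=> 0).
Proof.
move=> kN; apply/funext => x; apply: ell2_eqP => t.
rewrite -[LHS]/(ell2_extend x (k^-1 * val t)%g) ell2_extend_notin//.
apply: contra kN => ktN; have tN : val t \in N by exact: valP.
by rewrite -gpredV -(gpredMr _ tN).
Qed.

Definition induced_ideal (R : realType) (K : groupType) (N : groupClosed K)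
    (J : set (ell2 R (subgroup N) -> ell2 R (subgroup N))) :
    set (ell2 R K -> ell2 R K) :=
  [set b | reduced_algebra R K b /\
     forall x y, reduced_algebra R K x -> reduced_algebra R K y ->
       J (expectation N (x \o b \o y))].

(* Main.v *)
Require Import Defs.
From HB Require Import structures.
From mathcomp Require Import all_boot all_order all_algebra.
From mathcomp Require Import sesquilinear complex finmap ring lra.
From mathcomp Require Import all_classical all_reals all_analysis.

Set Implicit Arguments.
Unset Strict Implicit.
Unset Printing Implicit Defensive.

Import Order.TTheory GRing.Theory Num.Theory.
Import numFieldNormedType.Exports.

Local Open Scope classical_set_scope.
Local Open Scope ring_scope.

Local Notation normc := ComplexField.Normc.normc.

(** Let N be the direct sum of copies of Z/2Z indexed by G/H, let K be the
    wreath product, let q0 be the trivial coset, and let chi be the character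
    f |-> (-1)^(f q0) of N.  Its stabilizer in G is H.  Inducing the character
    of N ><| H that extends chi and is trivial on H gives the representation
    pi of K on ell2(G/H) (lamp_rep) in which N acts by the signs (-1)^(f q) and
    G permutes the cosets.  The ideal I is the kernel of pi on C*_r(K).

    - pi extends to C*_r(K).  Since H is amenable, the coefficient of pi at the
      cyclic vector delta_q0 is a pointwise limit of coefficients of the regular
      representation (lamp_rep_weakly_contained): almost invariant vectors xi of
      H are spread over K by means of a vector v supported on N on which
      finitely many prescribed elements of N act through chi
      (lamp_eigenvector).  The GNS argument turns convergence of coefficients
      into the norm inequality ||pi(a)|| <= ||lambda(a)|| on the group algebra
      (cyclic_weakly_contained), and this inequality lets pi pass to the norm
      closure (weakly_contained_extends).  Almost invariant vectors are obtained
      from an invariant mean by the Hahn-Banach theorem (amenable_reiter).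

    - pi is irreducible.  If f is the lamp at the coset q, then 1 - pi(f) is
      twice the projection onto the line of delta_q, and G permutes the vectors
      delta_q transitively (lamp_rep_irreducible).

    - I is not induced.  Let f be the lamp at q0 and let h <> 1 be in H.
      As h fixes q0, the element (h - 1)(1 - f) lies in I.  If I = Ind(J), then J
      contains the conditional expectations of the elements
      g^-1 h^-1 (h - 1)(1 - f) g, and these are 1 - g^-1 f g, because no conjugate
      of h^-1 or h^-1 f lies in N (expectation_stabilizer_element).  But then
      1 - f itself is in Ind(J) = I (induced_ideal_normal), whereas
      pi(1 - f) <> 0. *)

(** * The Hahn-Banach theorem *)

Section HahnBanach.
Variables (R : realType) (V : lmodType R).
Implicit Types (p q : V -> R).

(** Only one half of positive homogeneity is required: the other half is the same
    inequality at the inverse scalar. *)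
Record sublinear p : Prop := Sublinear {
  sublinearD : forall x y, p (x + y) <= p x + p y ;
  sublinearZ : forall c x, 0 < c -> p (c *: x) <= c * p x }.

Lemma sublinear_ge0 p x : sublinear p -> 0 <= p x + p (- x).
Proof.
move=> sp; have h2 : p 0 <= p x + p (- x) by rewrite -{1}(subrr x) sublinearD.
apply: le_trans h2; have := sublinearZ sp 0 (@ltr0Sn R 1).
by rewrite scaler0 -subr_ge0 mulr2n mulrDl mul1r addrK.
Qed.

Lemma sublinearZE p c x : sublinear p -> 0 < c -> p (c *: x) = c * p x.
Proof.
move=> sp c0; apply/le_anti; rewrite sublinearZ//=.
have ci : 0 < c^-1 by rewrite invr_gt0.
have := sublinearZ sp (c *: x) ci.
by rewrite scalerA mulVf ?gt_eqF// scale1r ler_pdivlMl.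
Qed.

(** Zorn's lemma applies because the pointwise infimum of a chain of sublinear
    functionals q below p is finite, as q x >= - p (- x), and is sublinear. *)
Lemma minimal_sublinear p : sublinear p ->
  exists q, [/\ sublinear q, forall x, q x <= p x &
    forall q', sublinear q' -> (forall x, q' x <= q x) -> q' = q].
Proof.
move=> sp.
pose T := {q : V -> R | sublinear q /\ forall x, q x <= p x}.
pose below : rel T := fun q q' : T => `[< forall x, sval q' x <= sval q x >].
have [||||[q [sq qp]] qmin] := @Zorn T below.
- by move=> q; apply/asboolP.
- by move=> r s t /asboolP rs /asboolP st; apply/asboolP => x; apply: le_trans (rs x).
- move=> [s s'] [t t'] /asboolP/= st /asboolP/= ts; apply/eq_exist/funext => x.
  by apply/le_anti; rewrite st ts.
- move=> A Atot.
  have [[q0 Aq0]|A0] := pselect (exists q : T, A q); last first.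
    exists (exist _ p (conj sp (fun x => lexx (p x)))) => s As.
    by exfalso; apply: A0; exists s.
  pose E x := [set sval (q : T) x | q in A].
  have lbE x : has_lbound (E x).
    exists (- p (- x)) => _ [q Aq <-]; have [sq qp] := svalP q.
    rewrite lerNl; apply: le_trans (qp (- x)).
    by have := sublinear_ge0 x sq; rewrite addrC -lerBlDr sub0r.
  have neE x : E x !=set0 by exists (sval q0 x), q0.
  have EL x (q : T) : A q -> inf (E x) <= sval q x.
    by move=> Aq; apply: ge_inf => //; exists q.
  have s_inf : sublinear (fun x => inf (E x)).
    split=> [x y|c x c0].
      rewrite -lerBlDr; apply: lb_le_inf => // _ [q Aq <-].
      rewrite lerBlDr -lerBlDl; apply: lb_le_inf => // _ [q' Aq' <-].
      rewrite lerBlDl.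
      have [sq _] := svalP q; have [sq' _] := svalP q'.
      have [/asboolP le|/asboolP le] := Atot _ _ Aq Aq'.
        apply: le_trans (EL _ _ Aq') _; apply: le_trans (sublinearD sq' x y) _.
        by rewrite lerD2r.
      apply: le_trans (EL _ _ Aq) _; apply: le_trans (sublinearD sq x y) _.
      by rewrite lerD2l.
    rewrite -ler_pdivrMl//; apply: lb_le_inf => // _ [q Aq <-].
    have [sq _] := svalP q; rewrite ler_pdivrMl//.
    by apply: le_trans (EL _ _ Aq) _; apply: sublinearZ.
  have inf_p x : inf (E x) <= p x.
    by apply: le_trans (EL _ _ Aq0) _; case: (svalP q0).
  exists (exist _ (fun x => inf (E x)) (conj s_inf inf_p)) => q Aq.
  by apply/asboolP => x /=; exact: EL.
exists q; split => // q' sq' q'q.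
have q'p x : q' x <= p x by exact: le_trans (q'q x) (qp x).
have [] // : exist _ q' (conj sq' q'p) = exist _ q (conj sq qp) :> T.
by apply: qmin; apply/asboolP.
Qed.

(** For fixed x, the infimum over t > 0 of q (y + t x) - t q x is sublinear in y
    and is at most q, so by minimality it is q; the value t = 1 then gives
    superadditivity. *)
Lemma minimal_sublinear_scalar q : sublinear q ->
  (forall q', sublinear q' -> (forall x, q' x <= q x) -> q' = q) -> scalar q.
Proof.
move=> sq qmin.
have superadd x y : q y + q x <= q (y + x).
  pose E z := [set q (z + t *: x) - t * q x | t in [set t : R | 0 < t]].
  have lbE z : has_lbound (E z).
    exists (- q (- z)) => _ [t t0 <-].
    have := sublinearD sq (z + t *: x) (- z).
    by rewrite addrAC subrr add0r (sublinearZE _ sq t0); lra.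
  have neE z : E z !=set0 by exists (q (z + 1 *: x) - 1 * q x), 1 => //=.
  pose q' z := inf (E z).
  have EL z t : 0 < t -> q' z <= q (z + t *: x) - t * q x.
    by move=> t0; apply: ge_inf => //; exists t.
  have qq' : q = q'.
    apply/esym/qmin => [|z].
      split=> [z z'|c z c0].
        rewrite -lerBlDr; apply: lb_le_inf => // _ [t t0 <-].
        rewrite lerBlDr -lerBlDl; apply: lb_le_inf => // _ [t' t'0 <-].
        rewrite lerBlDl.
        apply: le_trans (EL _ (t + t') (addr_gt0 t0 t'0)) _.
        have := sublinearD sq (z + t *: x) (z' + t' *: x).
        by rewrite scalerDl addrACA mulrDl; lra.
      rewrite -ler_pdivrMl//; apply: lb_le_inf => // _ [t t0 <-].
      rewrite ler_pdivrMl//; apply: le_trans (EL _ (c * t) (mulr_gt0 c0 t0)) _.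
      by rewrite -scalerA -scalerDr sublinearZE// mulrBr mulrA.
    apply: le_trans (EL z 1 ltr01) _; rewrite scale1r mul1r lerBlDr.
    exact: sublinearD.
  by have := EL y 1 ltr01; rewrite -qq' scale1r mul1r lerBrDr.
have qD x y : q (x + y) = q x + q y.
  by apply/le_anti; rewrite sublinearD//= superadd.
have q0 : q 0 = 0 by have := qD 0 0; rewrite addr0; lra.
have qN x : q (- x) = - q x by have := qD x (- x); rewrite subrr q0; lra.
move=> c x y; rewrite qD; congr (_ + _) => /=.
have [c0|c0|->] := ltrgtP c 0; last by rewrite scale0r mul0r.
  by rewrite -{1}[c]opprK scaleNr qN sublinearZE ?oppr_gt0 // mulNr opprK.
by rewrite sublinearZE.
Qed.

Theorem hahn_banach p : sublinear p ->
  exists2 L : V -> R, scalar L & forall x, L x <= p x.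
Proof.
move=> /minimal_sublinear[q [sq qp qmin]].
by exists q => //; exact: minimal_sublinear_scalar.
Qed.

End HahnBanach.

(** * Sums of real families *)

Section SummableFamilies.
Variables (R : realType).

Lemma rsumB (T : choiceType) (a b : T -> R) : rsummable a -> rsummable b ->
  rsum (fun t => a t - b t) = rsum a - rsum b.
Proof.
move=> sa sb; rewrite -(rsumN sb) -rsumD//.
by apply: rsummable_le sb => t; rewrite normrN.
Qed.

Lemma rsummableB (T : choiceType) (a b : T -> R) : rsummable a -> rsummable b ->
  rsummable (fun t => a t - b t).
Proof.
move=> sa sb; apply: rsummableD => //.
by apply: rsummable_le sb => t; rewrite normrN.
Qed.

Lemma rsummable_norm (T : choiceType) (a : T -> R) :
  rsummable a -> rsummable (fun t => `|a t|).
Proof. by apply: rsummable_le => t; rewrite normr_id. Qed.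

Lemma ler_rsum (T : choiceType) (a b : T -> R) : rsummable a -> rsummable b ->
  (forall t, a t <= b t) -> rsum a <= rsum b.
Proof.
move=> sa sb ab; rewrite -subr_ge0 -rsumB//; apply: rsum_ge0.
  by move=> t; rewrite subr_ge0.
exact: rsummableB.
Qed.

Lemma rsum_fset (T : choiceType) (X : {fset T}) (a : T -> R) :
  (forall t, t \notin X -> a t = 0) ->
  rsummable a /\ rsum a = \sum_(t <- X) a t.
Proof.
have of_ge0 (b : T -> R) : (forall t, 0 <= b t) -> (forall t, t \notin X -> b t = 0) ->
    rsummable b /\ rsum b = \sum_(t <- X) b t.
  move=> b0 bX; have [sb le] : rsummable b /\ rsum b <= \sum_(t <- X) b t.
    apply: rsum_fin_le => // Y.
    rewrite (bigID (mem X))/= [X in _ + X]big1 ?addr0 => [|t /bX//].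
    rewrite [leRHS](bigID (mem Y))/= -[leLHS]addr0 lerD ?sumr_ge0//.
    rewrite -[leLHS]big_filter -[leRHS]big_filter le_eqVlt; apply/orP; left.
    apply/eqP/perm_big/uniq_perm; do ?[by rewrite filter_uniq ?fset_uniq].
    by move=> t; rewrite !mem_filter andbC.
  by split=> //; apply/le_anti; rewrite le ler_rsum_fin.
move=> aX.
have m0 (x : R) : 0 <= Num.max x 0 by rewrite le_max lexx orbT.
have [|sp ep] := of_ge0 (fun t => Num.max (a t) 0) (fun t => m0 (a t)).
  by move=> t /aX ->; rewrite maxxx.
have [|sn en] := of_ge0 (fun t => Num.max (- a t) 0) (fun t => m0 (- a t)).
  by move=> t /aX ->; rewrite oppr0 maxxx.
have ae : a = (fun t => Num.max (a t) 0 - Num.max (- a t) 0).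
  by apply/funext => t; rewrite !maxEle; case: ifP; case: ifP; lra.
split; first by rewrite ae; exact: rsummableB.
rewrite ae rsumB// ep en -sumrB.
by apply: eq_bigr.
Qed.

Lemma rsum1 (T : choiceType) (a : T -> R) t : (forall s, s != t -> a s = 0) ->
  rsummable a /\ rsum a = a t.
Proof.
move=> at0; have [|sa ->] := @rsum_fset T [fset t]%fset a.
  by move=> s; rewrite inE => /at0.
by split=> //; rewrite big_seq_fset1.
Qed.

Lemma rsum_bij (T U : choiceType) (h : U -> T) (a : T -> R) :
  bijective h -> rsum (a \o h) = rsum a.
Proof.
move=> bh; have sb : set_bij [set: U] [set: T] h.
  by rewrite setTT_bijective.
by rewrite /rsum !(@reindex_esum R U T _ _ h _ sb).
Qed.

End SummableFamilies.

(** * Finitely supported functions *)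

Section FiniteSupport.
Variables (R : realType) (T : choiceType).

Definition fin_support : {pred T -> R^o} :=
  fun f => `[< finite_set [set t | f t != 0] >].

Lemma fin_support_submod : submod_closed fin_support.
Proof.
split=> [|c f g /asboolP ff /asboolP gf]; apply/asboolP.
  rewrite (_ : [set _ | _] = set0)// -subset0 => t /=.
  by rewrite eqxx.
have /sub_finite_set : [set t | (c *: f + g) t != 0] `<=`
    [set t | f t != 0] `|` [set t | g t != 0].
  move=> t /= cfg; apply: contrapT => /not_orP[/negP + /negP].
  rewrite !negbK => /eqP f0 /eqP g0; move: cfg.
  by rewrite -[_ t]/(c * f t + g t) f0 g0 addr0 mulr0 eqxx.
by apply; rewrite finite_setU.
Qed.
HB.instance Definition _ := GRing.isSubmodClosed.Build R (T -> R^o) fin_support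
  fin_support_submod.

Record fsupp := Fsupp { fsupp_fun :> T -> R^o ; fsuppP : fsupp_fun \in fin_support }.
HB.instance Definition _ := [isSub for fsupp_fun].
HB.instance Definition _ := [Choice of fsupp by <:].
HB.instance Definition _ := [SubChoice_isSubLmodule of fsupp by <:].


Implicit Types f g : fsupp.

Lemma fsupp_eqP f g : f =1 g -> f = g.
Proof. by move=> fg; apply/val_inj/funext. Qed.

Lemma fsupp_fset f : exists X : {fset T}, forall t, t \notin X -> f t = 0.
Proof.
have /asboolP ff := fsuppP f; exists (fset_set [set t | f t != 0]) => t.
by rewrite in_fset_set//= notin_setE/= => /negP; rewrite negbK => /eqP.
Qed.

Lemma fsupp_summable f : rsummable f.
Proof. by have [X /rsum_fset[]] := fsupp_fset f. Qed.

Definition mass f : R := rsum f.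
Definition norm1 f : R := rsum (fun t => `|f t|).

Lemma mass_linear c f g : mass (c *: f + g) = c * mass f + mass g.
Proof.
rewrite /mass -rsumZ; last exact: fsupp_summable.
rewrite -rsumD; [by []|apply: rsummableZ|]; exact: fsupp_summable.
Qed.

Lemma norm1_ge0 f : 0 <= norm1 f.
Proof. by apply: rsum_ge0 => //; exact/rsummable_norm/fsupp_summable. Qed.

Lemma norm1D f g : norm1 (f + g) <= norm1 f + norm1 g.
Proof.
have [sf sg] := (rsummable_norm (fsupp_summable f), rsummable_norm (fsupp_summable g)).
rewrite /norm1 -rsumD//; apply: ler_rsum.
- exact/rsummable_norm/fsupp_summable.
- exact: rsummableD.
- by move=> t; exact: ler_normD.
Qed.

Lemma norm1Z c f : norm1 (c *: f) = `|c| * norm1 f.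
Proof.
rewrite /norm1 -rsumZ; last exact/rsummable_norm/fsupp_summable.
by congr rsum; apply/funext => t; rewrite -normrM.
Qed.

Lemma ler_mass_norm1 f : `|mass f| <= norm1 f.
Proof.
have sf := fsupp_summable f.
have sn := rsummable_norm sf.
have snN : rsummable (fun t => - `|f t|).
  by apply: rsummable_le sn => t; rewrite normrN.
rewrite ler_norml /mass /norm1 -(rsumN sn); apply/andP; split; apply: ler_rsum => // t.
  by rewrite lerNl -normrN ler_norm.
exact: ler_norm.
Qed.

Lemma dirac_subproof t : (fun s => (s == t)%:R : R^o) \in fin_support.
Proof.
apply/asboolP; apply: (@sub_finite_set _ _ [set t]) => // s /=.
by apply: contraNeq => /negbTE ->.
Qed.
Definition point_mass t := Fsupp (dirac_subproof t).

Lemma mass_point t : mass (point_mass t) = 1.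
Proof.
have [|_] := @rsum1 R T (point_mass t) t; first by move=> s /= /negbTE ->.
by rewrite /mass => ->; rewrite /= eqxx.
Qed.

Lemma norm1_point t : norm1 (point_mass t) = 1.
Proof.
rewrite -(mass_point t); congr rsum; apply/funext => s /=.
by rewrite ger0_norm.
Qed.

End FiniteSupport.

(** * Reiter's condition for amenable groups *)

Section Reiter.
Variables (R : realType) (L : groupType).
Implicit Types (f g : fsupp R L) (s x : L).

Lemma translate_subproof s f :
  (fun x => f (s^-1 * x)%g : R^o) \in @fin_support R L.
Proof.
have /asboolP ff := fsuppP f; apply/asboolP.
apply: (@sub_finite_set _ _ ((fun x => s * x)%g @` [set x | f x != 0])).
  by move=> x /= fx; exists (s^-1 * x)%g => //; rewrite mulVKg.
exact: finite_image.
Qed.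
Definition translate s f := Fsupp (translate_subproof s f).

Lemma translateD s f g : translate s (f + g) = translate s f + translate s g.
Proof. exact: fsupp_eqP. Qed.

Lemma translateZ s c f : translate s (c *: f) = c *: translate s f.
Proof. exact: fsupp_eqP. Qed.

Lemma translate_point s x : translate s (point_mass R x) = point_mass R (s * x)%g.
Proof.
by apply: fsupp_eqP => y /=; congr (_%:R); rewrite -(inj_eq (mulgI s)) mulVKg.
Qed.

Lemma bounded_funP (a : L -> R) :
  bounded_fun a <-> exists C, forall x, `|a x| <= C.
Proof.
split=> [[M [_ Ma]]|[C aC]].
  by exists (M + 1) => x; apply: (Ma (M + 1)) => //; rewrite ltrDl.
by exists C; split; [exact: num_real|move=> M /ltW CM x _; exact: le_trans CM].
Qed.

(** A mean annihilates the left-hand side, being invariant, and sends 1 to 1. *)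
Lemma no_bounded_flow (I : finType) (s : I -> L) (phi : I -> L -> R) :
  amenable R L -> (forall i, bounded_fun (phi i)) ->
  ~ forall x, \sum_i (phi i x - phi i (s i * x)%g) = 1.
Proof.
move=> [m [m_lin _ m1 m_inv]] bphi flow.
have bD c (a b : L -> R) : bounded_fun a -> bounded_fun b ->
    bounded_fun (fun x => c * a x + b x).
  move=> /bounded_funP[A aA] /bounded_funP[B bB]; apply/bounded_funP.
  exists (`|c| * A + B) => x; apply: le_trans (ler_normD _ _) _.
  by rewrite lerD// normrM ler_wpM2l.
have b0 : bounded_fun (fun _ : L => 0 : R).
  by apply/bounded_funP; exists 0 => x; rewrite normr0.
have m0 : m (fun=> 0) = 0.
  have := m_lin (-1) _ _ b0 b0.
  under [in LHS]eq_fun do rewrite mulr0 addr0.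
  by rewrite mulN1r addNr.
have bs i : bounded_fun (fun x => phi i (s i * x)%g).
  have /bounded_funP[C phiC] := bphi i.
  by apply/bounded_funP; exists C => x; exact: phiC.
have ms i : m (fun x => phi i (s i * x)%g) = m (phi i).
  by rewrite -(m_inv (s i)^-1%g (phi i))//; congr m; apply/funext => x; rewrite invgK.
suff main (r : seq I) :
    bounded_fun (fun x => \sum_(i <- r) (phi i x - phi i (s i * x)%g)) /\
    m (fun x => \sum_(i <- r) (phi i x - phi i (s i * x)%g)) = 0.
  have [_] := main (index_enum I).
  rewrite (_ : (fun _ => _) = fun=> 1) ?m1; last exact/funext.
  by move/eqP; rewrite oner_eq0.
elim: r => [|i r [bih mih]].
  rewrite (_ : (fun _ => _) = fun=> 0)//.
  by apply/funext => x; rewrite big_nil.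
rewrite (_ : (fun _ => _) = (fun x => -1 * phi i (s i * x)%g +
    (1 * phi i x + \sum_(i <- r) (phi i x - phi i (s i * x)%g)))); last first.
  by apply/funext => x; rewrite big_cons; ring.
split; first by apply: (bD) => //; apply: (bD).
by rewrite !m_lin//; [rewrite mih ms; ring|exact: bD].
Qed.

Lemma abs_subproof f : (fun x => `|f x| : R^o) \in @fin_support R L.
Proof.
have /asboolP ff := fsuppP f; apply/asboolP.
by apply: sub_finite_set ff => x /=; rewrite normr_eq0.
Qed.
Definition fsupp_abs f := Fsupp (abs_subproof f).

Lemma norm1_abs_translate s f :
  norm1 (fsupp_abs f - translate s (fsupp_abs f)) <= norm1 (f - translate s f).
Proof.
apply: ler_rsum => [||x]; do ?exact/rsummable_norm/fsupp_summable.
exact: ler_dist_dist.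
Qed.

(** If the condition fails for S and e, then rescaling shows that every finitely
    supported f satisfies |sum f| <= C * sum_s ||f - s f||_1 with C = 1/e.  Hence
    the functional sending the family d f = (f - s f)_s to the sum of f is well
    defined and C-bounded, and it extends to a C-bounded functional on all
    S-indexed families.  The extension is a family of bounded functions phi_s,
    and evaluating it at d of a point mass gives
    sum_s (phi_s x - phi_s (s x)) = 1, which no_bounded_flow excludes. *)
Theorem amenable_reiter (S : seq L) (e : R) : amenable R L -> 0 < e ->
  exists f, [/\ forall x, 0 <= f x, mass f = 1 &
    forall s, s \in S -> norm1 (f - translate s f) <= e].
Proof.
move=> amL e0; apply: contrapT => noReiter.
pose n := size S; pose s (i : 'I_n) := tnth (in_tuple S) i.
pose V : lmodType R := {ffun 'I_n -> fsupp R L}.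
pose d f : V := [ffun i => f - translate (s i) f].
pose nrm (u : V) : R := \sum_i norm1 (u i).
pose C := e^-1; have C0 : 0 < C by rewrite invr_gt0.
have dD f g : d (f + g) = d f + d g.
  by apply/ffunP => i; rewrite !ffunE translateD opprD addrACA.
have dZ c f : d (c *: f) = c *: d f.
  by apply/ffunP => i; rewrite !ffunE translateZ scalerBr.
have massD f g : mass (f + g) = mass f + mass g.
  by rewrite -[f]scale1r mass_linear mul1r scale1r.
have mass0 : mass (0 : fsupp R L) = 0.
  by have := massD 0 0; rewrite addr0; lra.
have massZ c f : mass (c *: f) = c * mass f.
  by rewrite -[c *: f]addr0 mass_linear mass0 addr0.
have norm10 : norm1 (0 : fsupp R L) = 0.
  by rewrite -(scale0r (0 : fsupp R L)) norm1Z normr0 mul0r.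
have nrm_ge0 u : 0 <= nrm u by apply: sumr_ge0 => i _; exact: norm1_ge0.
have nrmD u v : nrm (u + v) <= nrm u + nrm v.
  by rewrite -big_split; apply: ler_sum => i _; rewrite ffunE norm1D.
have nrmZ c u : nrm (c *: u) = `|c| * nrm u.
  by rewrite /nrm big_distrr; apply: eq_bigr => i _; rewrite ffunE norm1Z.
have nrmN u : nrm (- u) = nrm u by rewrite -scaleN1r nrmZ normrN1 mul1r.
have nrm0 : nrm 0 = 0 by rewrite -(scale0r (0 : V)) nrmZ normr0 mul0r.
have isop f : `|mass f| <= C * nrm (d f).
  apply: le_trans (ler_mass_norm1 f) _.
  have := norm1_ge0 f; rewrite le_eqVlt => /predU1P[<-|a0].
    by rewrite mulr_ge0// ltW.
  pose g := (norm1 f)^-1 *: fsupp_abs f.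
  have [s0 s0S] : exists2 s0, s0 \in S & e < norm1 (g - translate s0 g).
    apply: contrapT => nos; apply: noReiter; exists g; split => [x||s0 s0S].
    - by rewrite -[g x]/(_^-1 * `|f x|) mulr_ge0// invr_ge0 ltW.
    - by rewrite massZ mulVf// gt_eqF.
    - by rewrite leNgt; apply/negP => es0; apply: nos; exists s0.
  rewrite translateZ -scalerBr norm1Z.
  rewrite ger0_norm ?invr_ge0 ?(ltW a0)// ltr_pdivlMl// => /ltW ea.
  rewrite ler_pdivlMl// mulrC; apply: le_trans ea _.
  apply: le_trans (norm1_abs_translate _ _) _.
  have [i <-] : exists i, s i = s0.
    have /(tnthP (in_tuple S)) [i ->] := s0S.
    by exists i.
  rewrite /nrm (bigD1 i)//= ffunE lerDl.
  by apply: sumr_ge0 => j _; exact: norm1_ge0.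
(* The linear functionals below p are the C-bounded ones with value mass f at d f. *)
pose E u := [set C * nrm (u - d f) + mass f | f in [set: fsupp R L]].
pose p u := inf (E u).
have lbE u : lbound (E u) (- (C * nrm u)).
  move=> _ [f _ <-]; have := isop f; rewrite ler_norml => /andP[h _].
  have := nrmD (u - d f) (- u); rewrite addrAC subrr add0r !nrmN.
  by rewrite -(ler_pM2l C0); lra.
have hlE u : has_lbound (E u) by exists (- (C * nrm u)).
have neE u : E u !=set0 by exists (C * nrm (u - d 0) + mass (0 : fsupp R L)), 0.
have pE u f : p u <= C * nrm (u - d f) + mass f.
  by apply: ge_inf => //; exists f.
have sp : sublinear p.
  split=> [u v|c u c0].
    rewrite -lerBlDr; apply: lb_le_inf => // _ [f _ <-].
    rewrite lerBlDr -lerBlDl; apply: lb_le_inf => // _ [g _ <-].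
    rewrite lerBlDl; apply: le_trans (pE _ (f + g)) _.
    have := nrmD (u - d f) (v - d g); rewrite addrACA -opprD -dD massD.
    by rewrite -(ler_pM2l C0) mulrDr => h; rewrite [leRHS]addrACA lerD2r.
  rewrite -ler_pdivrMl//; apply: lb_le_inf => // _ [f _ <-].
  rewrite ler_pdivrMl//; apply: le_trans (pE _ (c *: f)) _.
  rewrite dZ -scalerBr nrmZ massZ (gtr0_norm c0) [leRHS]mulrDr.
  by rewrite [leLHS]addrC [leRHS]addrC lerD2l mulrCA.
have [l l_lin lp] := hahn_banach sp.
pose ll : {scalar V} := HB.pack l (GRing.isLinear.Build _ _ _ _ l l_lin).
have lN u : l (- u) = - l u by exact: (raddfN ll).
have ld f : l (d f) = mass f.
  have le g : l (d g) <= mass g.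
    by apply: le_trans (lp _) _; apply: le_trans (pE _ g) _; rewrite subrr nrm0; lra.
  apply/le_anti; rewrite le/=; have := le (-1 *: f).
  by rewrite dZ massZ scaleN1r lN mulN1r lerN2.
have l_le u : `|l u| <= C * nrm u.
  have le v : l v <= C * nrm v.
    apply: le_trans (lp _) _; apply: le_trans (pE _ (0 *: 0)) _.
    by rewrite dZ massZ scale0r mul0r subr0 addr0.
  by rewrite ler_norml le andbT lerNl -lN -(nrmN u).
pose e_ i g : V := [ffun j => if j == i then g else 0].
pose phi i x := l (e_ i (point_mass R x)).
apply: (@no_bounded_flow 'I_n s phi) => // [i|x].
  apply/bounded_funP; exists C => x; apply: le_trans (l_le _) _.
  rewrite /nrm (bigD1 i)//= ffunE eqxx norm1_point big1 ?addr0 ?mulr1// => j ji.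
  by rewrite ffunE (negbTE ji).
rewrite -(mass_point R x) -ld.
have -> : d (point_mass R x) =
    \sum_i (e_ i (point_mass R x) - e_ i (point_mass R (s i * x)%g)).
  apply/ffunP => i; rewrite sum_ffunE (bigD1 i)//= big1 ?addr0 => [|j ji].
    by rewrite !ffunE eqxx translate_point.
  by rewrite !ffunE eq_sym (negbTE ji) subr0.
apply: etrans (esym (raddf_sum ll _ _ _)).
by apply: eq_bigr => i _; exact/esym/(raddfB ll).
Qed.

End Reiter.

(** * Hilbert spaces and unitary representations *)

Section HilbertSpace.
Variables (R : realType) (V : hilbertType R).
Implicit Types (x y z : V) (c : R[i]).

Lemma innerBl x y z : inner (x - y) z = inner x z - inner y z.
Proof. by rewrite linearBl. Qed.

Lemma innerZl c x z : inner (c *: x) z = c * inner x z.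
Proof. by rewrite linearZl_LR. Qed.

Lemma innerBr x y z : inner z (x - y) = inner z x - inner z y.
Proof. by rewrite linearBr. Qed.

Lemma innerZr c x z : inner z (c *: x) = Num.conj c * inner z x.
Proof. by rewrite linearZr_LR. Qed.

Lemma inner_suml (I : Type) (r : seq I) (F : I -> V) z :
  inner (\sum_(i <- r) F i) z = \sum_(i <- r) inner (F i) z.
Proof. by rewrite linear_sumlz. Qed.

Lemma inner_sumr (I : Type) (r : seq I) (F : I -> V) z :
  inner z (\sum_(i <- r) F i) = \sum_(i <- r) inner z (F i).
Proof. by rewrite linear_sumr. Qed.

Lemma inner_conj x y : inner y x = Num.conj (inner x y).
Proof. by rewrite hermC expr0 mul1r. Qed.

Lemma ler_inner x y : `|inner x y| <= `|x| * `|y|.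
Proof.
rewrite -(@ler_pXn2r _ 2) ?nnegrE ?mulr_ge0//.
by rewrite exprMn -!inner_norm; exact: dot_CauchySchwarz.
Qed.

End HilbertSpace.

Section Operators.
Variables (R : realType) (V : hilbertType R).
Implicit Types (a b : V -> V) (e : R[i]).

(** For e >= 0 this says that the operator norm of a - b is at most e. *)
Definition op_close e a b := forall x, `|a x - b x| <= e * `|x|.

Lemma op_closeC e a b : op_close e a b -> op_close e b a.
Proof. by move=> ab x; rewrite distrC. Qed.

Lemma op_close_trans e1 e2 a b c :
  op_close e1 a b -> op_close e2 b c -> op_close (e1 + e2) a c.
Proof.
move=> ab bc x; rewrite -(subrKA (b x)) mulrDl.
by apply: le_trans (ler_normD _ _) _; rewrite lerD.
Qed.

Lemma op_closeW e1 e2 a b : e1 <= e2 -> op_close e1 a b -> op_close e2 a b.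
Proof. by move=> e12 ab x; apply: le_trans (ab x) _; rewrite ler_wpM2r. Qed.

(** The constant C absorbs errors that add up, such as 4 e. *)
Lemma op_close_eq C a b : (forall e, 0 < e -> op_close (e * C) a b) -> a = b.
Proof.
move=> ab; apply/funext => x; apply/eqP; rewrite -subr_eq0 -normr_le0.
have C0 : 0 <= C * `|x|.
  by rewrite -[C]mul1r; apply: le_trans (ab 1 ltr01 x).
apply/ler_addgt0Pr => e e0; rewrite add0r.
have k0 : 0 < 1 + C * `|x| by rewrite ltr_pwDl.
apply: le_trans (ab (e / (1 + C * `|x|)) (divr_gt0 e0 k0) x) _.
by rewrite -mulrA mulrAC ler_pdivrMr// ler_pM2l// lerDr ler01.
Qed.

Lemma linear_bounded_operator a : linear a -> (exists2 C, 0 <= C &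
  forall x, `|a x| <= C * `|x|) -> bounded_operator a.
Proof.
move=> lin_a [C C0 aC]; split=> //.
pose aL : {linear V -> V} := HB.pack a (GRing.isLinear.Build _ _ _ _ a lin_a).
apply: (@bounded_linear_continuous _ _ _ aL).
apply/linear_boundedP; exists C; split; first exact: ger0_real.
by move=> M CM x; apply: le_trans (aC x) _; rewrite ler_wpM2r// ltW.
Qed.

End Operators.

Section UnitaryRepresentation.
Variables (R : realType) (K : groupType) (V : hilbertType R).

Record unitary_rep (U : K -> V -> V) : Prop := UnitaryRep {
  urep_linear : forall k, linear (U k) ;
  urep1 : forall x, U 1%g x = x ;
  urepM : forall k l x, U (k * l)%g x = U k (U l x) ;
  urep_inner : forall k x y, inner (U k x) (U k y) = inner x y }.

Implicit Types (p q : seq (R[i] * K)).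

(** An element of the group algebra is a list of coefficients and group elements,
    possibly with repetitions, so that products and adjoints are computed on
    lists; comb U p is its image under U. *)
Definition comb (U : K -> V -> V) p (x : V) := \sum_(a <- p) a.1 *: U a.2 x.

Definition comb_scale (c : R[i]) p := [seq (c * a.1, a.2) | a <- p].
Definition comb_mul p q := [seq ((a.1 * b.1), (a.2 * b.2)%g) | a <- p, b <- q].
Definition comb_adj p := [seq (Num.conj a.1, (a.2)^-1%g) | a <- p].

Variables (U : K -> V -> V) (rU : unitary_rep U).

Lemma urep_norm k x : `|U k x| = `|x|.
Proof.
apply/eqP; rewrite -(@eqrXn2 _ 2)// -!inner_norm; apply/eqP.
exact: urep_inner.
Qed.

Lemma urep_adj k x y : inner (U k x) y = inner x (U k^-1%g y).
Proof. by rewrite -(urep_inner rU k^-1%g) -(urepM rU) mulVg (urep1 rU). Qed.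

Lemma urep0 k : U k 0 = 0.
Proof.
have := urep_linear rU k (-1) 0 0.
by rewrite scaler0 addr0 scaleN1r addNr.
Qed.

Lemma urepZ k c x : U k (c *: x) = c *: U k x.
Proof. by rewrite -[c *: x]addr0 (urep_linear rU) urep0 addr0. Qed.

Lemma urepD k x y : U k (x + y) = U k x + U k y.
Proof. by rewrite -[x]scale1r (urep_linear rU) !scale1r. Qed.

Lemma urep_sum k (I : Type) (r : seq I) (F : I -> V) :
  U k (\sum_(i <- r) F i) = \sum_(i <- r) U k (F i).
Proof.
elim: r => [|i r ih]; last by rewrite !big_cons urepD ih.
by rewrite !big_nil urep0.
Qed.

Lemma comb_linear p : linear (comb U p).
Proof.
move=> c x y; rewrite /comb scaler_sumr -big_split; apply: eq_bigr => a _.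
by rewrite /= urepD urepZ scalerDr !scalerA mulrC.
Qed.

Lemma comb_nil : comb U [::] = fun=> 0.
Proof. by apply/funext => x; rewrite /comb big_nil. Qed.

Lemma comb_cat p q x : comb U (p ++ q) x = comb U p x + comb U q x.
Proof. by rewrite /comb big_cat. Qed.

Lemma comb_scaleE c p x : comb U (comb_scale c p) x = c *: comb U p x.
Proof.
rewrite /comb big_map scaler_sumr.
by apply: eq_bigr => a _; rewrite scalerA.
Qed.

Lemma comb_mulE p q x : comb U (comb_mul p q) x = comb U p (comb U q x).
Proof.
rewrite /comb big_allpairs_dep; apply: eq_bigr => a _.
rewrite urep_sum scaler_sumr; apply: eq_bigr => b _.
by rewrite urepZ scalerA (urepM rU).
Qed.

Lemma comb_adjE p x y : inner (comb U p x) y = inner x (comb U (comb_adj p) y).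
Proof.
rewrite /comb big_map inner_suml inner_sumr; apply: eq_bigr => a _.
by rewrite innerZl innerZr conjCK urep_adj.
Qed.

Definition comb_norm p : R[i] := \sum_(a <- p) `|a.1|.

Lemma comb_norm_ge0 p : 0 <= comb_norm p.
Proof. exact: sumr_ge0. Qed.

Lemma ler_comb p x : `|comb U p x| <= comb_norm p * `|x|.
Proof.
rewrite /comb /comb_norm big_distrl /=; apply: le_trans (ler_norm_sum _ _ _) _.
by apply: ler_sum => a _; rewrite normrZ urep_norm.
Qed.

Lemma comb_bounded p : bounded_operator (comb U p).
Proof.
apply: linear_bounded_operator (comb_linear p) _.
by exists (comb_norm p); [exact: comb_norm_ge0|exact: ler_comb].
Qed.

Lemma inner_comb_comb p q x :
  inner (comb U p x) (comb U q x) =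
  \sum_(a <- p) \sum_(b <- q) a.1 * Num.conj b.1 * inner (U (b.2^-1 * a.2)%g x) x.
Proof.
rewrite /comb inner_suml; apply: eq_bigr => a _.
rewrite inner_sumr; apply: eq_bigr => b _.
by rewrite innerZl innerZr mulrA (urepM rU) (urep_adj b.2^-1%g) invgK.
Qed.

End UnitaryRepresentation.

(** * Weak containment and extension to the norm closure *)

Lemma approx_complete (R : realType) (W : completeNormedModType R[i])
    (u : R -> W) (C : R[i]) : 0 <= C ->
  (forall d e, 0 < d -> 0 < e -> `|u d - u e| <= (d + e)%:C%C * C) ->
  exists l, u @ 0^'+ --> l /\ forall e, 0 < e -> `|l - u e| <= (e *+ 2)%:C%C * C.
Proof.
move=> C0 uC.
have Ck : 0 < 1 + C by rewrite ltr_pwDl.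
have small (e : R[i]) : 0 < e -> exists2 d : R, 0 < d &
    forall d', 0 < d' -> d' < d -> (d + d')%:C%C * C < e.
  move=> e0; pose c := e / (1 + C); have c0 : 0 < c by rewrite divr_gt0.
  have cR : c = (complex.Re c)%:C%C.
    by case: (c) c0 => a b; rewrite ltcE /= => /andP[/eqP ->].
  have d0 : 0 < complex.Re c by move: c0; rewrite ltcE => /andP[].
  exists (complex.Re c / 2); first by rewrite divr_gt0.
  move=> d' d'0 d'd; apply: (@le_lt_trans _ _ (c * C)).
    by rewrite ler_wpM2r// cR lecR; lra.
  by rewrite /c mulrAC ltr_pdivrMr// ltr_pM2l// ltrDr.
have cu : cvg (u @ 0^'+).
  apply/cauchy_cvgP/cauchy_exP => e /small[d d0 dP]; exists (u d).
  suff : \forall d' \near (0 : R)^'+, ball (u d) e (u d') by [].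
  near=> d'; rewrite -ball_normE /ball_ /=.
  have d'0 : 0 < d' by near: d'; exact: nbhs_right_gt.
  have d'd : d' < d by near: d'; exact: nbhs_right_lt.
  exact: le_lt_trans (uC d d' d0 d'0) (dP d' d'0 d'd).
exists (lim (u @ 0^'+)); split=> // e e0.
apply/ler_addgt0Pr => k k0.
have := @cvgrPdist_le _ _ _ _ (at_right_proper_filter 0) u (lim (u @ 0^'+)).
move=> [/(_ cu k k0) H _].
near (0:R)^'+ => d.
have h1 : `|lim (u @ 0^'+) - u d| <= k by near: d; exact: H.
have h2 : `|u d - u e| <= (e *+ 2)%:C%C * C.
  apply: le_trans (uC d e _ e0) _ => //; rewrite ler_wpM2r// lecR mulr2n lerD2r.
  by near: d; exact: nbhs_right_le.
rewrite -(subrKA (u d)) [leRHS]addrC; apply: le_trans (ler_normD _ _) _.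
by rewrite lerD.
Unshelve. all: by end_near. Qed.

Section WeakContainment.
Variables (R : realType) (K : groupType) (V W : hilbertType R).
Variables (U : K -> V -> V) (U' : K -> W -> W).
Hypotheses (rU : unitary_rep U) (rU' : unitary_rep U').

Definition weakly_contained := forall p (M : R[i]), 0 <= M ->
  (forall x, `|comb U p x| <= M * `|x|) -> forall w, `|comb U' p w| <= M * `|w|.

Hypothesis wc : weakly_contained.

Let A : set (V -> V) := norm_closure (range (comb U)).

(** The graph of the extension: a and b are limits of the images of the same
    elements of the group algebra. *)
Definition approximated a b := forall e : R[i], 0 < e ->
  exists p, op_close e a (comb U p) /\ op_close e b (comb U' p).

Lemma comb_close e p q : 0 <= e -> op_close e (comb U p) (comb U q) ->
  op_close e (comb U' p) (comb U' q).
Proof.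
move=> e0 pq w; have -> : comb U' p w - comb U' q w = comb U' (p ++ comb_scale (-1) q) w.
  by rewrite comb_cat comb_scaleE scaleN1r.
by apply: wc => // x; rewrite comb_cat comb_scaleE scaleN1r.
Qed.

Lemma norm_closure_comb a : A a -> forall e : R[i], 0 < e ->
  exists p, op_close e a (comb U p).
Proof.
move=> [_ aA] e e0; have eR : e = (complex.Re e)%:C%C.
  by case: (e) e0 => x y; rewrite ltcE /= => /andP[/eqP ->].
have Re0 : 0 < complex.Re e by move: e0; rewrite ltcE => /andP[].
have [_ [p _ <-] ap] := aA _ Re0.
by exists p; rewrite eR.
Qed.

Lemma approximated_unique a b b' :
  approximated a b -> approximated a b' -> b = b'.
Proof.
move=> ab ab'; apply: (@op_close_eq _ _ 4) => e e0.
have [p [ap bp]] := ab _ e0; have [q [aq bq]] := ab' _ e0.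
have := op_close_trans (op_closeC ap) aq.
move=> /(comb_close (ltW (addr_gt0 e0 e0))) pq.
have := op_close_trans bp (op_close_trans pq (op_closeC bq)).
by apply: op_closeW; rewrite le_eqVlt; apply/orP; left; apply/eqP; ring.
Qed.

Lemma approximated_comb p : approximated (comb U p) (comb U' p).
Proof.
by move=> e e0; exists p; split=> x; rewrite subrr normr0 mulr_ge0// ltW.
Qed.

Lemma approximated_linear c a b a' b' : approximated a b -> approximated a' b' ->
  approximated (fun x => c *: a x + a' x) (fun w => c *: b w + b' w).
Proof.
move=> ab ab' e e0; have k0 : 0 < `|c| + 1 by rewrite ltr_wpDl.
have e1 : 0 < e / (`|c| + 1) by rewrite divr_gt0.
have [p [ap bp]] := ab _ e1; have [q [aq bq]] := ab' _ e1.
exists (comb_scale c p ++ q).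
have main (X : hilbertType R) (T : K -> X -> X) (f g : X -> X) :
    unitary_rep T -> op_close (e / (`|c| + 1)) f (comb T p) ->
    op_close (e / (`|c| + 1)) g (comb T q) ->
    op_close e (fun x => c *: f x + g x) (comb T (comb_scale c p ++ q)).
  move=> rT fp gq x; rewrite comb_cat comb_scaleE opprD addrACA -scalerBr.
  apply: le_trans (ler_normD _ _) _; rewrite normrZ.
  have -> : e * `|x| = `|c| * (e / (`|c| + 1) * `|x|) + e / (`|c| + 1) * `|x|.
    by field; rewrite gt_eqF.
  by rewrite lerD// ler_wpM2l.
by split; apply: main.
Qed.

(** The error of a product is controlled by a bound C for a and b, read off from
    one fixed approximant p1, and by a bound for the approximant q of the right
    factor; q is chosen before the approximant p of the left factor. *)
Lemma approximated_comp a b a' b' : linear a -> linear b ->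
  approximated a b -> approximated a' b' ->
  approximated (a \o a') (b \o b').
Proof.
move=> la lb ab ab' e e0.
have [p1 [ap1 bp1]] := ab _ ltr01.
pose C := 1 + comb_norm p1.
have C0 : 0 < C by rewrite ltr_pwDl// comb_norm_ge0.
have bnd (X : hilbertType R) (T : K -> X -> X) (f : X -> X) : unitary_rep T ->
    op_close 1 f (comb T p1) -> forall x, `|f x| <= C * `|x|.
  move=> rT fp x; rewrite -[f x](subrK (comb T p1 x)) mulrDl.
  by apply: le_trans (ler_normD _ _) _; rewrite lerD// ler_comb.
pose e1 := e / (2 * C); have e10 : 0 < e1 by rewrite divr_gt0// mulr_gt0.
have [q [aq bq]] := ab' _ e10.
pose e2 := e / (2 * (1 + comb_norm q)).
have Cq : 0 < 1 + comb_norm q by rewrite ltr_pwDl// comb_norm_ge0.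
have e20 : 0 < e2 by rewrite divr_gt0// mulr_gt0.
have [p [ap bp]] := ab _ e20.
exists (comb_mul p q).
have main (X : hilbertType R) (T : K -> X -> X) (f g : X -> X) :
    unitary_rep T -> linear f -> op_close 1 f (comb T p1) ->
    op_close e2 f (comb T p) -> op_close e1 g (comb T q) ->
    op_close e (f \o g) (comb T (comb_mul p q)).
  move=> rT lf fp1 fp gq x; rewrite (comb_mulE rT) /=.
  rewrite -(subrKA (f (comb T q x))); apply: le_trans (ler_normD _ _) _.
  have -> : e * `|x| = C * (e1 * `|x|) + e2 * ((1 + comb_norm q) * `|x|).
    by rewrite /e1 /e2; field; rewrite !gt_eqF.
  apply: lerD.
    have -> : f (g x) - f (comb T q x) = f (g x - comb T q x).
      by rewrite addrC -scaleN1r -lf scaleN1r addrC.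
    apply: le_trans (bnd _ _ _ rT fp1 _) _.
    by rewrite ler_wpM2l// ltW.
  apply: le_trans (fp _) _; rewrite ler_wpM2l ?(ltW e20)//.
  apply: le_trans (ler_comb rT _ _) _.
  by rewrite ler_wpM2r// lerDr ler01.
by split; apply: main.
Qed.

(** If p approximates a and q approximates its adjoint a', then p^* and q have
    close images under U.  Weak containment carries this to U', where q
    approximates b' and p^* is adjoint to an approximant of b. *)
Lemma approximated_adjoint a b a' b' : approximated a b -> approximated a' b' ->
  adjoint_pair a a' -> adjoint_pair b b'.
Proof.
move=> ab ab' aa' x y; apply/eqP; rewrite -subr_eq0 -normr_le0.
pose D := 4 * `|x| * `|y| + 1.
have D0 : 0 < D by rewrite ltr_wpDl// !mulr_ge0.
apply/ler_addgt0Pr => k k0; rewrite add0r.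
pose e := k / D; have e0 : 0 < e by rewrite divr_gt0.
have [p [ap bp]] := ab _ e0; have [q [aq bq]] := ab' _ e0.
have close : op_close (e + e) (comb U (comb_adj p)) (comb U q).
  move=> v; have [z zE] : exists z, z = comb U (comb_adj p) v - comb U q v.
    by eexists.
  rewrite -zE.
  have [->|z0] := eqVneq z 0; first by rewrite normr0 mulr_ge0// addr_ge0// ltW.
  have e1 : inner (comb U (comb_adj p) v) z = inner v (comb U p z).
    by rewrite [LHS]inner_conj -(comb_adjE rU) -inner_conj.
  have e2 : inner v (a z) = inner (a' v) z.
    by rewrite [LHS]inner_conj aa' -inner_conj.
  have zz : inner z z = inner v (comb U p z - a z) + inner (a' v - comb U q v) z.
    rewrite innerBr (innerBl (a' v)) e2 addrA subrK -e1.
    by rewrite -innerBl -zE.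
  rewrite -(@ler_pM2r _ `|z|) ?normr_gt0//.
  have -> : `|z| * `|z| = `|inner z z| by rewrite inner_norm normrX normr_id expr2.
  rewrite zz; apply: le_trans (ler_normD _ _) _; rewrite !mulrDl; apply: lerD.
    apply: le_trans (ler_inner _ _) _; rewrite mulrC [leRHS]mulrAC ler_wpM2r//.
    by rewrite -normrN opprB.
  by apply: le_trans (ler_inner _ _) _; rewrite ler_wpM2r.
have close' := comb_close (ltW (addr_gt0 e0 e0)) close.
have -> : inner (b x) y - inner x (b' y) = inner (b x - comb U' p x) y
    + (inner x (comb U' (comb_adj p) y - comb U' q y)
    + inner x (comb U' q y - b' y)).
  by rewrite innerBl !innerBr (comb_adjE rU'); ring.
have -> : k = e * `|x| * `|y| + (`|x| * ((e + e) * `|y|) + `|x| * (e * `|y|)) + e.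
  have -> : k = e * D by rewrite /e mulfVK// gt_eqF.
  by rewrite /D; ring.
rewrite -[leLHS]addr0; apply: lerD; last exact: ltW.
apply: le_trans (ler_normD _ _) _; apply: lerD.
  by apply: le_trans (ler_inner _ _) _; rewrite ler_wpM2r.
apply: le_trans (ler_normD _ _) _; apply: lerD.
  by apply: le_trans (ler_inner _ _) _; rewrite ler_wpM2l.
by apply: le_trans (ler_inner _ _) _; rewrite ler_wpM2l// -normrN opprB.
Qed.

Lemma approximated_bounded a b : linear b -> approximated a b -> bounded_operator b.
Proof.
move=> lb ab; apply: linear_bounded_operator => //; have [p [_ bp]] := ab _ ltr01.
exists (1 + comb_norm p); first by rewrite addr_ge0// comb_norm_ge0.
move=> x; rewrite -[b x](subrK (comb U' p x)) mulrDl.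
by apply: le_trans (ler_normD _ _) _; rewrite lerD// ler_comb.
Qed.

(** Weak containment makes the images under U' of approximants of a a Cauchy
    family at each vector; b is its pointwise limit. *)
Lemma approximated_exists a : A a -> exists b, linear b /\ approximated a b.
Proof.
move=> Aa.
have /choice[p pP] : forall e : R, exists p, 0 < e -> op_close e%:C%C a (comb U p).
  move=> e; have [e0|e0] := ltP 0 e; last by exists [::].
  by have [|p ap] := norm_closure_comb Aa (e := e%:C%C); [rewrite ltcR|exists p].
have p_close d e : 0 < d -> 0 < e ->
    op_close (d + e)%:C%C (comb U' (p d)) (comb U' (p e)).
  move=> d0 e0; apply: comb_close; first by rewrite lecR addr_ge0 ?ltW.
  rewrite rmorphD.
  by apply: op_close_trans (pP _ e0); exact/op_closeC/pP.
have /choice[b bP] : forall w, exists l, comb U' (p e) w @[e --> 0^'+] --> l /\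
    forall e, 0 < e -> `|l - comb U' (p e) w| <= (e *+ 2)%:C%C * `|w|.
  move=> w; apply: approx_complete => // d e d0 e0; exact: p_close.
exists b; split.
  move=> c x y; have [h1 _] := bP (c *: x + y).
  have h2 : comb U' (p e) (c *: x + y) @[e --> 0^'+] --> c *: b x + b y.
    under eq_fun do rewrite (comb_linear rU').
    apply: cvgD; last by have [] := bP y.
    by apply: cvgZl_tmp; have [] := bP x.
  exact: (cvg_unique (@norm_hausdorff _ _) h1 h2).
move=> e e0; have eR : e = (complex.Re e)%:C%C.
  by case: (e) e0 => x y; rewrite ltcE /= => /andP[/eqP ->].
have Re0 : 0 < complex.Re e by move: e0; rewrite ltcE => /andP[].
have h0 : 0 < complex.Re e / 2 by rewrite divr_gt0.
have eE : (complex.Re e / 2 *+ 2)%:C%C = e by rewrite mulr2n -splitr -eR.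
exists (p (complex.Re e / 2)); split.
  by apply: op_closeW (pP _ h0); rewrite -[leRHS]eE lecR mulr2n lerDl ltW.
by move=> w; have [_ /(_ _ h0)] := bP w; rewrite eE.
Qed.

(** Every property of rho is a property of approximants, transferred by the
    uniqueness of the approximated operator. *)
Theorem weakly_contained_extends :
  exists rho, is_representation (norm_closure (range (comb U))) rho /\
    forall p, rho (comb U p) = comb U' p.
Proof.
pose rho a := xget (fun=> 0) [set b | approximated a b].
have rhoP a b : approximated a b -> rho a = b.
  move=> ab; apply: (fun h => approximated_unique h ab).
  by apply: (xgetPex (fun=> 0)); exists b.
have rhoA a : A a -> linear (rho a) /\ approximated a (rho a).
  by move=> /approximated_exists[b [lb ab]]; rewrite (rhoP _ _ ab).
exists rho; split; last by move=> p; exact/rhoP/approximated_comb.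
split=> [a /rhoA[la aa]|c a b /rhoA[_ aa] /rhoA[_ ab]|a b Aa Ab|
    a b /rhoA[_ aa] /rhoA[_ ab]].
- exact: approximated_bounded aa.
- exact/rhoP/approximated_linear.
- have [la aa] := rhoA _ Aa; have [_ ab] := rhoA _ Ab.
  by apply/rhoP/approximated_comp => //; case: Aa => -[].
- exact: approximated_adjoint.
Qed.

End WeakContainment.

(** * Weak containment from coefficients *)

Section CyclicVector.
Variables (R : realType) (K : groupType) (V W : hilbertType R).
Variables (U : K -> V -> V) (U' : K -> W -> W).
Hypotheses (rU : unitary_rep U) (rU' : unitary_rep U').

Lemma coefficients_close (phi phi' : K -> R[i]) (e : R[i]) (p : seq (R[i] * K)) :
  0 <= e ->
  (forall a b, a \in p -> b \in p ->
    `|phi (b.2^-1 * a.2)%g - phi' (b.2^-1 * a.2)%g| <= e) ->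
  `|\sum_(a <- p) \sum_(b <- p) a.1 * Num.conj b.1 * phi (b.2^-1 * a.2)%g -
    \sum_(a <- p) \sum_(b <- p) a.1 * Num.conj b.1 * phi' (b.2^-1 * a.2)%g|
  <= e * comb_norm p ^+ 2.
Proof.
move=> e0 close; rewrite -sumrB; apply: le_trans (ler_norm_sum _ _ _) _.
have -> : e * comb_norm p ^+ 2 =
    \sum_(a <- p) \sum_(b <- p) `|a.1| * `|b.1| * e.
  rewrite mulrC expr2 /comb_norm big_distrlr /= mulr_suml.
  by apply: eq_bigr => a _; rewrite mulr_suml.
rewrite big_seq [leRHS]big_seq.
apply: ler_sum => a ap; rewrite -sumrB; apply: le_trans (ler_norm_sum _ _ _) _.
rewrite big_seq [leRHS]big_seq; apply: ler_sum => b bp.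
by rewrite -mulrBr !normrM norm_conjC ler_wpM2l ?mulr_ge0// close.
Qed.

(** By the GNS construction ||U'(p) U'(q) d||^2 and ||U'(q) d||^2 are finite sums
    of values of the coefficient k |-> <U'_k d, d>.  Replacing that coefficient by
    <U_k eta, eta> changes them arbitrarily little, and for U the inequality
    between them is the bound M for U(p).  The vectors U'(q) d are dense. *)
Theorem cyclic_weakly_contained (d : W) :
  (forall w (e : R[i]), 0 < e -> exists p, `|w - comb U' p d| <= e) ->
  (forall (S : seq K) (e : R[i]), 0 < e -> exists eta : V, forall k, k \in S ->
     `|inner (U k eta) eta - inner (U' k d) d| <= e) ->
  weakly_contained U U'.
Proof.
move=> cyc approx p M M0 pM.
have main q : `|comb U' p (comb U' q d)| <= M * `|comb U' q d|.
  rewrite -(@ler_pXn2r _ 2) ?nnegrE ?mulr_ge0// exprMn -(comb_mulE rU').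
  set r := comb_mul p q; apply/ler_addgt0Pr => k k0.
  pose D := comb_norm r ^+ 2 + M ^+ 2 * comb_norm q ^+ 2.
  have D0 : 0 <= D by rewrite addr_ge0 ?mulr_ge0 ?exprn_ge0 ?comb_norm_ge0.
  pose e := k / (1 + D); have e0 : 0 < e by rewrite divr_gt0// ltr_pwDl.
  pose quot s := [seq ((b : R[i] * K).2^-1 * (a : R[i] * K).2)%g | a <- s, b <- s].
  have [eta etaP] := approx (quot r ++ quot q) e e0.
  have close s : {subset quot s <= quot r ++ quot q} ->
      `| `|comb U s eta| ^+ 2 - `|comb U' s d| ^+ 2| <= e * comb_norm s ^+ 2.
    move=> sub; rewrite -!inner_norm (inner_comb_comb rU) (inner_comb_comb rU').
    apply: (@coefficients_close (fun k => inner (U k eta) eta)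
      (fun k => inner (U' k d) d)) => [|a b ap bp]; first exact: ltW.
    by apply/etaP/sub/allpairsP; exists (a, b).
  have real_sq (X : hilbertType R) (x : X) : `|x| ^+ 2 \is Num.real.
    by rewrite realX// normr_real.
  have h1 := close r; have h2 := close q.
  have {h1} h1 : `|comb U' r d| ^+ 2 <= `|comb U r eta| ^+ 2 + e * comb_norm r ^+ 2.
    rewrite -lerBlDl; apply: le_trans (h1 _); last first.
      by move=> x xr; rewrite mem_cat xr.
    by rewrite distrC real_ler_norm// realB.
  have {h2} h2 : `|comb U q eta| ^+ 2 <= `|comb U' q d| ^+ 2 + e * comb_norm q ^+ 2.
    rewrite -lerBlDl; apply: le_trans (h2 _); last first.
      by move=> x xr; rewrite mem_cat xr orbT.
    by rewrite real_ler_norm// realB.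
  apply: le_trans h1 _.
  have h3 : `|comb U r eta| ^+ 2 <= M ^+ 2 * `|comb U q eta| ^+ 2.
    rewrite /r (comb_mulE rU) -exprMn ler_pXn2r ?nnegrE ?mulr_ge0//.
  have M20 : 0 <= M ^+ 2 by rewrite exprn_ge0.
  have := le_trans h3 (ler_wpM2l M20 h2); rewrite -(lerD2r (e * comb_norm r ^+ 2)).
  move=> /le_trans; apply; rewrite mulrDr -addrA lerD2l.
  have -> : M ^+ 2 * (e * comb_norm q ^+ 2) + e * comb_norm r ^+ 2 = e * D.
    by rewrite /D; ring.
  by rewrite /e mulrAC ler_pdivrMr ?ltr_pwDl// ler_pM2l// lerDr.
move=> w; apply/ler_addgt0Pr => k k0.
pose C := M + comb_norm p; have C0 : 0 <= C by rewrite addr_ge0// comb_norm_ge0.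
pose e := k / (1 + C); have e0 : 0 < e by rewrite divr_gt0// ltr_pwDl.
have [q wq] := cyc w e e0.
set z := comb U' q d in wq.
have -> : comb U' p w = comb U' p z + comb U' p (w - z).
  have := comb_linear rU' p 1 z (w - z); rewrite !scale1r => <-.
  by rewrite addrC subrK.
apply: le_trans (ler_normD _ _) _.
have h1 : `|comb U' p (w - z)| <= comb_norm p * e.
  by apply: le_trans (ler_comb rU' _ _) _; rewrite ler_wpM2l// comb_norm_ge0.
have h2 : `|comb U' p z| <= M * (`|w| + e).
  apply: le_trans (main q) _; rewrite ler_wpM2l// -lerBlDl.
  apply: le_trans wq; rewrite distrC; exact: lerB_dist.
apply: le_trans (lerD h2 h1) _; rewrite mulrDr -addrA lerD2l -mulrDl -/C.
by rewrite /e mulrCA ler_piMr ?(ltW k0)// ler_pdivrMr ?ltr_pwDl// mul1r lerDr.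
Qed.

End CyclicVector.

(** * Square summable functions and the regular representation *)

Section Ell2.
Variables (R : realType) (T : choiceType).
Implicit Types x y : ell2 R T.

Lemma csum1 (f : T -> R[i]) t : (forall s, s != t -> f s = 0) -> csum f = f t.
Proof.
move=> ft; rewrite /csum.
have [|_ ->] := @rsum1 R T (fun s => complex.Re (f s)) t; first by move=> s /ft ->.
have [|_ ->] := @rsum1 R T (fun s => complex.Im (f s)) t; first by move=> s /ft ->.
by case: (f t).
Qed.

Lemma csum_bij (S : choiceType) (h : S -> T) (f : T -> R[i]) : bijective h ->
  csum (f \o h) = csum f.
Proof.
move=> bh; rewrite /csum.
by rewrite -(rsum_bij (fun t => complex.Re (f t)) bh)
  -(rsum_bij (fun t => complex.Im (f t)) bh).
Qed.

Lemma inner_disjoint x y : (forall t, x t = 0 \/ y t = 0) -> inner x y = 0.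
Proof.
move=> xy; rewrite -[LHS]/(csum (fun t => x t * Num.conj (y t))).
rewrite (_ : (fun _ => _) = fun=> 0); last first.
  by apply/funext => t; case: (xy t) => ->; rewrite ?mul0r// conjC0 mulr0.
by rewrite /csum (_ : rsum _ = 0) // -(mul0r (rsum (fun _ : T => 0 : R)))
  -rsumZ ?mulr0//; have [] := @rsum_fset R T fset0 (fun=> 0) (fun _ _ => erefl).
Qed.

Lemma delta_subproof t : (fun s => (s == t)%:R) \in @square_summable R T.
Proof.
rewrite unfold_in; have [|] // := @rsum1 R T (fun s => normc ((s == t)%:R : R[i]) ^+ 2) t.
by move=> s /negbTE ->; rewrite ComplexField.Normc.normc0 expr0n.
Qed.
Definition delta t : ell2 R T := Ell2 (delta_subproof t).

Lemma inner_delta x t : inner x (delta t) = x t.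
Proof.
rewrite -[LHS]/(csum (fun s => x s * Num.conj ((s == t)%:R : R[i]))).
rewrite (csum1 (t := t)) ?eqxx ?conjC1 ?mulr1// => s /negbTE ->.
by rewrite conjC0 mulr0.
Qed.

Lemma inner_delta_delta s t : inner (delta s) (delta t) = (s == t)%:R.
Proof. by rewrite inner_delta /= eq_sym. Qed.

(** The finite partial sum y is the orthogonal projection of x, so that
    ||x - y||^2 = ||x||^2 - ||y||^2 is a tail of the series of ||x||^2. *)
Lemma delta_dense x (e : R[i]) : 0 < e ->
  exists s : seq T, `|x - \sum_(t <- s) x t *: delta t| <= e.
Proof.
move=> e0; have eR : e = (complex.Re e)%:C%C.
  by case: (e) e0 => a b; rewrite ltcE /= => /andP[/eqP ->].
have Re0 : 0 < complex.Re e by move: e0; rewrite ltcE => /andP[].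
pose a t := normc (x t) ^+ 2; have a0 t : 0 <= a t by exact: sqr_ge0.
have sa : rsummable a := ell2P x.
have [X Xa] : exists X : {fset T}, rsum a - complex.Re e ^+ 2 < \sum_(t <- X) a t.
  apply: contrapT => /forallNP noX.
  have [|_] := @rsum_fin_le R T a (rsum a - complex.Re e ^+ 2) a0.
    by move=> X; rewrite leNgt; apply/negP/noX.
  by rewrite lerBrDr gerDl leNgt exprn_gt0.
exists X; set y := \sum_(t <- X) _.
have yX t : t \in X -> y t = x t.
  move=> tX; rewrite -inner_delta inner_suml (bigD1_seq t)//= big1 => [|s st].
    by rewrite innerZl inner_delta_delta eqxx mulr1 addr0.
  by rewrite innerZl inner_delta_delta (negbTE st) mulr0.
have orth : inner (x - y) y = 0.
  rewrite {2}/y inner_sumr big_seq big1// => t tX.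
  by rewrite innerZr inner_delta ell2_addE ell2_oppE yX// subrr mulr0.
rewrite -(@ler_pXn2r _ 2) ?nnegrE ?normr_ge0 ?(ltW e0)//.
rewrite -inner_norm innerBr orth subr0 innerBl.
have -> : inner y x = (\sum_(t <- X) a t)%:C%C.
  rewrite inner_suml rmorph_sum; apply: eq_bigr => t _ /=.
  rewrite innerZl inner_conj inner_delta -normCK /a rmorphXn.
  by [].
have -> : inner x x = (rsum a)%:C%C by exact: ell2_innerxx.
by rewrite -rmorphB eR -rmorphXn lecR; lra.
Qed.

End Ell2.

Section RegularRepresentation.
Variables (R : realType) (K : groupType).

Lemma lambda_unitary : unitary_rep (@lambda R K).
Proof.
split=> [k c x y|x|k l x|k x y].
- exact: ell2_eqP.
- by apply: ell2_eqP => t; rewrite lambdaE invg1 mul1g.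
- by apply: ell2_eqP => t; rewrite !lambdaE invgM mulgA.
- apply: (@csum_bij R K K (fun t => k^-1 * t)%g (fun t => x t * Num.conj (y t))).
  by exists (fun t => k * t)%g => t; rewrite ?mulKg ?mulVKg.
Qed.

(** A list may repeat a group element; its coefficients are collected. *)
Lemma group_algebraE : @group_algebra_operators R K = range (comb (@lambda R K)).
Proof.
apply/seteqP; split=> [_ [s [c ->]]|_ [p _ <-]].
  exists [seq (c k, k) | k <- s] => //; apply/funext => x.
  by rewrite /comb big_map.
suff [s [us [c cE]]] : exists s : seq K, uniq s /\ exists c : K -> R[i],
    forall x, comb (@lambda R K) p x = \sum_(k <- s) c k *: lambda R k x.
  by exists s, c; apply/funext.
elim: p => [|[a k] p [s [us [c cE]]]].
  by exists [::]; split=> //; exists (fun=> 0) => x; rewrite /comb !big_nil.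
have [ks|ks] := boolP (k \in s).
  exists s; split=> //; exists (fun l => c l + (l == k)%:R * a) => x.
  rewrite /comb big_cons -[X in _ + X]/(comb _ p x) cE.
  under [in RHS]eq_bigr do rewrite scalerDl.
  rewrite big_split addrC; congr (_ + _).
  rewrite (bigD1_seq k)//= eqxx mul1r big1 ?addr0// => l /negbTE ->.
  by rewrite mul0r scale0r.
exists (k :: s); split; first by rewrite /= ks.
exists (fun l => if l == k then a else c l) => x.
rewrite /comb !big_cons -[X in _ + X]/(comb _ p x) cE eqxx; congr (_ + _).
apply: eq_big_seq => l ls; case: eqVneq => // lk.
by move: ks; rewrite -lk ls.
Qed.

Lemma reduced_algebraE :
  reduced_algebra R K = norm_closure (range (comb (@lambda R K))).
Proof. by rewrite /reduced_algebra group_algebraE. Qed.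

End RegularRepresentation.

(** * The representation on the coset space *)

Section LampRepresentation.
Variables (R : realType) (G : groupType) (H : groupClosed G).

Local Notation X := (coset_space H).

(** The character of the direct sum given by the coordinate q. *)
Definition lamp_sign (f : lamps H) (q : X) : R[i] := (-1) ^+ (f q : nat).

Lemma Z2_cases (a : 'Z_2) : a = 0 \/ a = 1.
Proof. by case: a => -[|[|//]] i; [left|right]; exact/val_inj. Qed.

Lemma lamp_sign0 q : lamp_sign 0 q = 1.
Proof. by []. Qed.

Lemma lamp_signD f g q : lamp_sign (f + g) q = lamp_sign f q * lamp_sign g q.
Proof.
rewrite /lamp_sign lamps_addE.
have [->|->] := Z2_cases (f q); have [->|->] := Z2_cases (g q);
  by rewrite /= ?expr0 ?expr1 ?mulr1 ?mul1r// mulrNN mulr1.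
Qed.

Lemma lamp_sign_act g f q :
  lamp_sign (lamps_act g f) q = lamp_sign f (coset_act g^-1%g q).
Proof. by []. Qed.

Lemma lamp_sign_conj f q : Num.conj (lamp_sign f q) = lamp_sign f q.
Proof. by rewrite /lamp_sign rmorphXn rmorphN1. Qed.

Lemma lamp_sign_sqr f q : lamp_sign f q * lamp_sign f q = 1.
Proof. by rewrite /lamp_sign -expr2 sqrr_sign. Qed.

Lemma coset_act_inj g : injective (coset_act g : X -> X).
Proof.
by apply: (@can_inj _ _ _ (coset_act g^-1%g)) => q; rewrite -coset_actM mulVg coset_act1.
Qed.

Lemma lamp_rep_subproof (k : wreath H) (w : ell2 R X) :
  (fun q => lamp_sign (wreath_lamps k) q * w (coset_act (wreath_base k)^-1%g q))
    \in @square_summable R X.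
Proof.
have := square_summable_comp (@coset_act_inj (wreath_base k)^-1%g) (ell2P w).
rewrite !unfold_in; apply: rsummable_le => q.
rewrite ComplexField.Normc.normcM /= /lamp_sign.
have -> : normc ((-1) ^+ (wreath_lamps k q : nat) : R[i]) = 1.
  have [->|->] := Z2_cases (wreath_lamps k q); rewrite ?expr0 ?expr1.
    exact: ComplexField.Normc.normc1.
  by rewrite normcN ComplexField.Normc.normc1.
by rewrite mul1r.
Qed.
(** The representation of the wreath product induced from the character of
    N ><| H that is lamp_sign at the trivial coset on N and trivial on H. *)
Definition lamp_rep (k : wreath H) (w : ell2 R X) : ell2 R X :=
  Ell2 (lamp_rep_subproof k w).

Lemma quasiE f g w q :
  lamp_rep (Wreath f g) w q = lamp_sign f q * w (coset_act g^-1%g q).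
Proof. by []. Qed.

Lemma lamp_rep_unitary : unitary_rep lamp_rep.
Proof.
split=> [[f g] c x y|x|[f g] [f' g'] x|[f g] x y].
- apply: ell2_eqP => q; rewrite ell2_addE ell2_scaleE !quasiE.
  by rewrite ell2_addE ell2_scaleE mulrDr mulrCA.
- by apply: ell2_eqP => q; rewrite quasiE lamp_sign0 mul1r invg1 coset_act1.
- apply: ell2_eqP => q; rewrite !quasiE lamp_signD lamp_sign_act.
  by rewrite invgM coset_actM mulrA.
- rewrite -[RHS](@csum_bij R X X (coset_act g^-1%g) (fun t => x t * Num.conj (y t))).
    congr csum; apply/funext => q; rewrite !quasiE rmorphM.
    by rewrite [X in _ * (X * _)]lamp_sign_conj mulrACA lamp_sign_sqr mul1r.
  by exists (coset_act g) => q; rewrite -coset_actM ?mulgV ?mulVg coset_act1.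
Qed.

Lemma lamp_rep_delta f g q :
  lamp_rep (Wreath f g) (delta R q) =
  lamp_sign f (coset_act g q) *: delta R (coset_act g q).
Proof.
apply: ell2_eqP => q'; rewrite quasiE ell2_scaleE /=.
have -> : (coset_act g^-1%g q' == q) = (q' == coset_act g q).
  by rewrite -(inj_eq (@coset_act_inj g)) -coset_actM mulgV coset_act1.
by case: eqVneq => [->//|_]; rewrite !mulr0.
Qed.

Definition base_coset : X := coset H 1%g.

Lemma lamp_rep_cyclic (w : ell2 R X) (e : R[i]) : 0 < e ->
  exists p, `|w - comb lamp_rep p (delta R base_coset)| <= e.
Proof.
move=> /(delta_dense w)[s ws]; exists [seq (w q, Wreath 0 (repr q)) | q <- s].
rewrite /comb big_map; apply: le_trans ws; rewrite le_eqVlt; apply/orP; left.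
apply/eqP; congr (`|w - _|); apply: eq_bigr => q _.
by rewrite lamp_rep_delta /base_coset coset_actE mulg1 coset_repr lamp_sign0 scale1r.
Qed.

Lemma lamp_at_subproof (q : X) :
  `[< finitely_supported (fun q' : X => ((q' == q)%:R : 'Z_2)) >].
Proof.
apply/asboolP; apply: (@sub_finite_set _ _ [set q]) => // q' /=.
by apply: contraNeq => /negbTE ->.
Qed.
Definition lamp_at q : lamps H := Lamps (lamp_at_subproof q).

Lemma lamp_sign_at q q' : lamp_sign (lamp_at q) q' = if q' == q then -1 else 1.
Proof. by rewrite /lamp_sign /=; case: eqVneq. Qed.

Lemma lamp_rep_lamp_at q w :
  w - lamp_rep (Wreath (lamp_at q) 1%g) w = (2 * w q) *: delta R q.
Proof.
apply: ell2_eqP => q'; rewrite ell2_addE ell2_oppE quasiE ell2_scaleE.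
rewrite invg1 coset_act1 lamp_sign_at /=.
by case: eqVneq => [->|_]; [rewrite mulN1r opprK mulr1; ring|rewrite mul1r subrr mulr0].
Qed.

End LampRepresentation.

(** * Weak containment in the regular representation *)

Section AlmostInvariant.
Variables (R : realType) (L : groupType).

(** With x, y the square roots: x |y - x| <= (y + x) |y - x|. *)
Lemma ler_sqrt_mul (a b : R) : 0 <= a -> 0 <= b ->
  `|Num.sqrt a * Num.sqrt b - a| <= `|b - a|.
Proof.
move=> a0 b0; have := sqr_sqrtr a0; have := sqr_sqrtr b0.
have := sqrtr_ge0 a; have := sqrtr_ge0 b.
move: (Num.sqrt a) (Num.sqrt b) => x y y0 x0 <- <-.
have -> : x * y - x ^+ 2 = x * (y - x) by ring.
have -> : y ^+ 2 - x ^+ 2 = (y + x) * (y - x) by ring.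
by rewrite !normrM ler_wpM2r// !ger0_norm ?addr_ge0// lerDr.
Qed.

(** xi is the square root of a function from Reiter's condition, so that
    |xi x xi (s x) - f x| <= |f (s x) - f x|. *)
Lemma amenable_almost_invariant (S : seq L) (e : R) : amenable R L -> 0 < e ->
  exists (X : {fset L}) (xi : L -> R), (forall x, x \notin X -> xi x = 0) /\
    forall s, s \in S -> `|\sum_(x <- X) xi x * xi (s * x)%g - 1| <= e.
Proof.
move=> amL e0.
have [f [f0 f1 fS]] := @amenable_reiter R L [seq s^-1%g | s <- S] e amL e0.
have [X fX] := fsupp_fset f.
exists X, (fun x => Num.sqrt (f x)); split=> [x /fX ->|s sS]; first exact: sqrtr0.
have [_ fE] := rsum_fset fX.
rewrite -f1 /mass fE -sumrB; apply: le_trans (ler_norm_sum _ _ _) _.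
apply: le_trans (fS s^-1%g _); last by rewrite map_f.
apply: (@le_trans _ _ (\sum_(x <- X) `|(f - translate s^-1%g f) x|)).
  apply: ler_sum => x _.
  have -> : (f - translate s^-1%g f) x = f x - f (s * x)%g.
    by rewrite -[LHS]/(f x - f (s^-1^-1 * x)%g) invgK.
  by rewrite [leRHS]distrC ler_sqrt_mul.
apply: ler_rsum_fin => //; exact/rsummable_norm/fsupp_summable.
Qed.

End AlmostInvariant.

Section WeakContainmentRegular.
Variables (R : realType) (G : groupType) (H : groupClosed G).

Local Notation lam := (@lambda R (wreath H)).
Local Notation chi f := (lamp_sign R f (base_coset H)).

Lemma lamp_mul (f f' : lamps H) :
  (Wreath f 1 * Wreath f' 1)%g = Wreath (f + f') 1%g.
Proof.
rewrite -[LHS]/(wreath_mul _ _) /wreath_mul /=.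
by rewrite lamps_act1 mulg1.
Qed.

Lemma lamp_inv (f : lamps H) : (Wreath f 1)^-1%g = Wreath (- f) 1%g.
Proof. by rewrite -[LHS]/(wreath_inv _) /wreath_inv /= invg1 lamps_act1. Qed.

Lemma lampDD (f : lamps H) : f + f = 0.
Proof.
apply: lamps_eqP => q; rewrite lamps_addE.
by have [->|->] := Z2_cases (f q); apply/val_inj.
Qed.

Lemma lampN (f : lamps H) : - f = f.
Proof. by apply/eqP; rewrite eq_sym -subr_eq0 opprK lampDD. Qed.

(** v is the product of the commuting operators 1 + chi(n) lambda_n, for n in the
    list, applied to delta_1: lambda_n multiplies the factor of n by chi(n), since
    n + n = 0.  It is nonzero because chi v is a nonnegative function on N
    with value at least 1 at the identity. *)
Lemma lamp_eigenvector (ns : seq (lamps H)) :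
  exists v : ell2 R (wreath H),
  [/\ v != 0, forall k, wreath_base k != 1%g -> v k = 0 &
      forall n, n \in ns -> lam (Wreath n 1%g) v = chi n *: v].
Proof.
suff [v [v1 vpos vsupp vn]] : exists v : ell2 R (wreath H),
  [/\ 1 <= v (Wreath 0 1%g), forall f, 0 <= chi f * v (Wreath f 1%g),
      forall k, wreath_base k != 1%g -> v k = 0 &
      forall n, n \in ns -> lam (Wreath n 1%g) v = chi n *: v].
  exists v; split=> //; apply: contraTneq v1 => ->.
  by rewrite -[X in _ <= X]/(0 : R[i]) ler10.
elim: ns => [|n ns [v [v1 vpos vsupp vn]]].
  exists (delta R (Wreath 0 1%g)); split=> //.
  - by rewrite /= eqxx.
  - move=> f /=; case: eqVneq => [[->]|_]; last by rewrite mulr0.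
    by rewrite lamp_sign0 mulr1 ler01.
  - move=> [f g] /= g1; case: eqVneq => // -[_ gE].
    by rewrite gE eqxx in g1.
have rl := lambda_unitary R (wreath H).
pose v' := v + chi n *: lam (Wreath n 1%g) v.
have v'E f g : v' (Wreath f g) = v (Wreath f g) + chi n * v (Wreath (n + f) g).
  rewrite ell2_addE ell2_scaleE lambdaE lamp_inv lampN.
  congr (_ + _ * v _); rewrite -[LHS]/(wreath_mul _ _) /wreath_mul /=.
  by rewrite lamps_act1 mul1g.
have v'pos f : 0 <= chi f * v' (Wreath f 1%g).
  rewrite v'E mulrDr addr_ge0// mulrA [chi f * _]mulrC -lamp_signD.
  exact: vpos.
exists v'; split=> //.
- rewrite v'E; apply: le_trans v1 _; rewrite lerDl addr0.
  exact: vpos.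
- by move=> [f g] g1; rewrite v'E !vsupp// mulr0 addr0.
- move=> n'; rewrite inE => /predU1P[->|n'ns].
    rewrite /v' (urepD rl) (urepZ rl) -(urepM rl) lamp_mul lampDD.
    rewrite scalerDr scalerA lamp_sign_sqr scale1r addrC.
    by congr (_ + _); congr (_ *: _); exact: (urep1 rl).
  rewrite /v' (urepD rl) (urepZ rl) -(urepM rl) lamp_mul [n' + n]addrC -lamp_mul.
  rewrite (urepM rl) vn// (urepZ rl) [in RHS]scalerDr; congr (_ + _).
  by rewrite !scalerA mulrC.
Qed.

(** The product y^-1 (f, t) x has the component y^-1 f in N, which is in the list,
    and chi is invariant under H.  For t x <> y the product is not in N and moves
    the support of v off itself. *)
Lemma lamp_eigenvector_translates (ns : seq (lamps H)) (v : ell2 R (wreath H))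
    f t x y :
  (forall k, wreath_base k != 1%g -> v k = 0) ->
  (forall n, n \in ns -> lam (Wreath n 1%g) v = chi n *: v) ->
  y \in H -> lamps_act y^-1%g f \in ns ->
  inner (lam (Wreath f t) (lam (Wreath 0 x) v)) (lam (Wreath 0 y) v) =
  (t * x == y)%g%:R * chi f * `|v| ^+ 2.
Proof.
move=> vsupp vn yH fns; have rl := lambda_unitary R (wreath H).
have kE : Wreath (lamps_act y^-1%g f) (y^-1 * (t * x))%g =
    ((Wreath 0 y)^-1 * (Wreath f t * Wreath 0 x))%g.
  rewrite -[RHS]/(wreath_mul (wreath_inv _) (wreath_mul _ _)).
  by rewrite /wreath_mul /wreath_inv /= !lamps_act0 addr0 oppr0 add0r.
have -> : inner (lam (Wreath f t) (lam (Wreath 0 x) v)) (lam (Wreath 0 y) v) =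
    inner (lam (Wreath (lamps_act y^-1%g f) (y^-1 * (t * x))%g) v) v.
  by rewrite kE !(urepM rl) [RHS](urep_adj rl) invgK.
case: eqVneq => [txy|txy].
  rewrite txy mulVg vn ?innerZl ?inner_norm//= mul1r; congr (_ * _).
  rewrite lamp_sign_act invgK /base_coset coset_actE mulg1.
  by congr (lamp_sign _ _ _); apply/esym/coset_eqP; rewrite invg1 mul1g.
rewrite !mul0r; apply: inner_disjoint => -[f' g'].
have [->|g1] := eqVneq g' 1%g; [left|right]; last exact: vsupp.
rewrite lambdaE; apply: vsupp.
rewrite -[wreath_base _]/((y^-1 * (t * x))^-1 * 1)%g mulg1 invg_eq1 mulg_eq1.
by rewrite eqg_inv eq_sym.
Qed.

Lemma lamp_rep_coefficient f t :
  inner (lamp_rep (Wreath f t) (delta R (base_coset H))) (delta R (base_coset H)) =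
  (t \in H)%:R * chi f.
Proof.
rewrite inner_delta quasiE mulrC; congr (_ * _) => /=; congr (_%:R).
rewrite /base_coset coset_actE mulg1; congr nat_of_bool.
by apply/eqP/idP => [/esym/coset_eqP|tH];
  [|apply/esym/coset_eqP]; rewrite invg1 mul1g gpredV.
Qed.

(** The coefficient of pi at delta_q0 vanishes outside N ><| H and is chi(f) at
    (f, t) with t in H.  With xi almost invariant on H and v an eigenvector for
    all y^-1 f, where y is in the support of xi and (f, t) in S, the vector
    eta = sum_x xi(x) lambda_x v / ||v|| has the coefficient
    chi(f) * sum_x xi(x) xi(t x) at (f, t) for t in H and 0 for t outside H. *)
Theorem lamp_rep_weakly_contained : amenable R (subgroup H) ->
  weakly_contained lam (@lamp_rep R G H).
Proof.
move=> amH; have rl := lambda_unitary R (wreath H).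
apply: (cyclic_weakly_contained rl (@lamp_rep_unitary R G H) (@lamp_rep_cyclic R G H)).
move=> S e e0; have eR : e = (complex.Re e)%:C%C.
  by case: (e) e0 => x y; rewrite ltcE /= => /andP[/eqP ->].
have Re0 : 0 < complex.Re e by move: e0; rewrite ltcE => /andP[].
pose bases : seq (subgroup H) := pmap insub [seq wreath_base k | k <- S].
have [X [xi [xiX xiS]]] := amenable_almost_invariant bases amH Re0.
pose ns := [seq lamps_act (val y)^-1%g (wreath_lamps k) | y <- X, k <- S].
have [v [v0 vsupp vn]] := lamp_eigenvector ns.
pose trans (x : subgroup H) : ell2 R (wreath H) := lam (Wreath 0 (val x)) v.
pose eta := `|v|^-1 *: \sum_(x <- X) (xi x)%:C%C *: trans x.
exists eta => -[f t] kS; rewrite lamp_rep_coefficient.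
pose c : R := \sum_(x <- X) \sum_(y <- X) xi x * xi y * (t * val x == val y)%g%:R.
have vn0 : `|v| != 0 by rewrite normr_eq0.
have -> : inner (lam (Wreath f t) eta) eta = c%:C%C * chi f.
  rewrite /eta (urepZ rl) innerZl innerZr (urep_sum rl) inner_suml.
  have -> : Num.conj `|v|^-1 = `|v|^-1 by apply/CrealP; rewrite realV normr_real.
  under eq_bigr => x _.
    rewrite (urepZ rl) innerZl inner_sumr big_seq.
    under eq_bigr => y yX.
      rewrite innerZr (lamp_eigenvector_translates (ns := ns))//; last 2 first.
      - exact: valP.
      - by apply/allpairsP; exists (y, Wreath f t).
      over.
    rewrite -big_seq; over.
  rewrite /c rmorph_sum !mulr_sumr mulr_suml; apply: eq_bigr => x _.
  rewrite rmorph_sum !mulr_sumr mulr_suml; apply: eq_bigr => y _.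
  rewrite !rmorphM /= rmorph_nat.
  have -> : Num.conj ((xi y)%:C%C) = (xi y)%:C%C :> R[i].
    by apply/CrealP; rewrite complex_real.
  by field.
rewrite -mulrBl normrM; have -> : `|chi f| = 1 by rewrite normrX normrN1 expr1n.
rewrite mulr1.
have [tH|tH] := boolP (t \in H); last first.
  rewrite subr0 /c big1 ?normr0 ?ltW// => x _; rewrite big1// => y _.
  case: eqP => [txy|]; last by rewrite mulr0.
  move: tH; rewrite -(gpredMr _ (valP x : val x \in H)) txy.
  by have := valP y; rewrite /= => ->.
have cE : c = \sum_(x <- X) xi x * xi (Sub t tH * x)%g.
  apply: eq_bigr => x _.
  have tE y : (t * val x == val y)%g = (y == Sub t tH * x)%g.
    by rewrite -(inj_eq val_inj) valM SubK eq_sym.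
  have [yX|yX] := boolP ((Sub t tH : subgroup H) * x \in X)%g.
    rewrite (bigD1_seq _ yX (fset_uniq X)) big1 => [|y /negbTE yx].
      by rewrite tE eqxx mulr1; exact: addr0.
    by rewrite tE yx mulr0.
  rewrite (xiX _ yX) mulr0 big_seq big1// => y yX'; rewrite tE.
  by case: eqVneq => [yE|_]; [rewrite yE (negbTE yX) in yX'|rewrite mulr0].
have -> : c%:C%C - 1 = (c - 1)%:C%C :> R[i] by rewrite rmorphB rmorph1.
rewrite eR normc_def /= expr0n addr0 sqrtr_sqr lecR cE; apply: xiS.
rewrite mem_pmap; apply/mapP; exists t; last by rewrite insubT.
by apply/mapP; exists (Wreath f t).
Qed.

End WeakContainmentRegular.

(** * Irreducibility *)

Section Combinations.
Variables (R : realType) (K : groupType) (V : hilbertType R) (U : K -> V -> V).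

Lemma comb_in_norm_closure p : unitary_rep U ->
  norm_closure (range (comb U)) (comb U p).
Proof.
move=> rU; split; first exact: comb_bounded.
move=> e e0; exists (comb U p); first by exists p.
by move=> x; rewrite subrr normr0 mulr_ge0// lecR ltW.
Qed.

Lemma comb_cons a p x : comb U (a :: p) x = a.1 *: U a.2 x + comb U p x.
Proof. by rewrite /comb big_cons. Qed.

Lemma comb1 k x : comb U [:: (1, k)] x = U k x.
Proof. by rewrite /comb big_seq1 scale1r. Qed.

Lemma combB k l x : comb U [:: (1, k); (-1, l)] x = U k x - U l x.
Proof. by rewrite !comb_cons comb_nil scale1r scaleN1r addr0. Qed.

End Combinations.

Section Irreducibility.
Variables (R : realType) (G : groupType) (H : groupClosed G).

Local Notation lam := (@lambda R (wreath H)).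
Local Notation A := (reduced_algebra R (wreath H)).

Lemma delta_neq0 (T : choiceType) (t : T) : delta R t != 0.
Proof.
apply/eqP => /(congr1 (fun x : ell2 R T => x t)); rewrite /= eqxx.
by move/eqP; rewrite oner_eq0.
Qed.

(** A nonzero closed invariant subspace contains some vector with a nonzero
    coordinate q; 1 - pi(lamp at q) maps it to a nonzero multiple of delta_q,
    translations give all the other delta_q', and these span a dense subspace. *)
Theorem lamp_rep_irreducible rho :
  (forall p, rho (comb lam p) = comb (@lamp_rep R G H) p) ->
  nonzero_irreducible A rho.
Proof.
move=> rhoE; rewrite reduced_algebraE.
have rl := lambda_unitary R (wreath H); have rq := @lamp_rep_unitary R G H.
have Acomb p := comb_in_norm_closure p rl.
split.
  exists (comb lam [:: (1, 1%g)]) => //; rewrite rhoE.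
  move=> /(congr1 (fun T => T (delta R (base_coset H)))); rewrite comb1 (urep1 rq).
  by apply/eqP; exact: delta_neq0.
move=> M [M0 Mlin Mclosed Minv].
have [Mtriv|[w Mw w0]] : M `<=` [set 0] \/ exists2 w, M w & w != 0.
  have [h|h] := pselect (exists2 w, M w & w != 0); [by right|left=> w Mw /=].
  by apply: contrapT => /eqP w0; apply: h; exists w.
  by left; apply/seteqP; split=> // _ ->.
right; apply/seteqP; split=> // x _.
have Mcomb p u : M u -> M (comb (@lamp_rep R G H) p u).
  by move=> Mu; rewrite -rhoE; exact: Minv.
have MZ c u : M u -> M (c *: u) by move=> Mu; rewrite -[_ *: _]addr0; exact: Mlin.
have [q wq] : exists q, w q != 0.
  apply: contrapT => /forallNP noq; move/eqP: w0; apply; apply: ell2_eqP => q.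
  by apply/eqP/negP => h; apply: (noq q); apply/negP.
have Mq : M (delta R q).
  have := Mcomb [:: (1, 1%g); (-1, Wreath (lamp_at q) 1%g)] w Mw.
  rewrite combB (urep1 rq) lamp_rep_lamp_at => /(MZ (2 * w q)^-1).
  by rewrite scalerA mulVf ?scale1r// mulf_neq0// pnatr_eq0.
have Md q' : M (delta R q').
  have := Mcomb [:: (1, Wreath 0 (repr q' * (repr q)^-1)%g)] _ Mq.
  rewrite comb1 lamp_rep_delta lamp_sign0 scale1r.
  by rewrite /coset_act mulgVK coset_repr.
have Ms (s : seq (coset_space H)) : M (\sum_(t <- s) x t *: delta R t).
  by elim: s => [|t s ih]; [rewrite big_nil|rewrite big_cons; apply: Mlin].
rewrite (closure_id M).1//; move=> B /nbhs_ballP[e /= e0 eB].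
have [|s xs] := delta_dense x (e := e / 2); first by rewrite divr_gt0.
exists (\sum_(t <- s) x t *: delta R t); split; first exact: Ms.
apply: eB; rewrite -ball_normE /ball_ /=; apply: le_lt_trans xs _.
by rewrite ltr_pdivrMr// ltr_pMr// ltr1n.
Qed.

End Irreducibility.

(** * The conditional expectation and induced ideals *)

Section Expectation.
Variables (R : realType) (K : groupType) (N : groupClosed K).

Lemma ell2_extend_linear : linear (@ell2_extend R K _ (subgroup N)).
Proof.
move=> c x y; apply: ell2_eqP => t; rewrite ell2_addE ell2_scaleE /=.
by case: insub => [u|] /=; rewrite ?ell2_addE ?ell2_scaleE// mulr0 addr0.
Qed.

Lemma ell2_normE (T : choiceType) (x : ell2 R T) :
  `|x| ^+ 2 = (rsum (fun t => normc (x t) ^+ 2))%:C%C.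
Proof. by rewrite ell2_norm_sqr ell2_innerxx. Qed.

Lemma ell2_comp_norm (T S : choiceType) (h : S -> T) (hi : injective h)
  (x : ell2 R T) : `|ell2_comp hi x| <= `|x|.
Proof.
rewrite -(@ler_pXn2r _ 2) ?nnegrE// !ell2_normE lecR.
have [] // := @rsum_fin_le R S (fun u => normc (x (h u)) ^+ 2)
  (rsum (fun t => normc (x t) ^+ 2)) (fun u => sqr_ge0 _).
move=> X; rewrite -[leLHS](big_map h xpredT (fun t => normc (x t) ^+ 2)).
by apply: ler_rsum_uniq; rewrite ?map_inj_uniq//; [move=> t; exact: sqr_ge0|exact: ell2P].
Qed.

Lemma ell2_extend_norm (x : ell2 R (subgroup N)) : `|ell2_extend x| <= `|x|.
Proof.
rewrite -(@ler_pXn2r _ 2) ?nnegrE// !ell2_normE lecR.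
pose b t := normc (ell2_extend x t) ^+ 2.
have [] // := @rsum_fin_le R K b (rsum (fun u => normc (x u) ^+ 2))
  (fun u => sqr_ge0 _).
move=> X; pose s : seq (subgroup N) := pmap insub X.
have -> : \sum_(t <- X) b t = \sum_(u <- s) normc (x u) ^+ 2.
  rewrite {}/s; elim: (X : seq K) => [|t l ih]; first by rewrite !big_nil.
  rewrite big_cons ih {1}/b /=; case: insub => [u|] /=; first by rewrite big_cons.
  rewrite -[X in X ^+ 2 + _]/(normc (0 : R[i])).
  by rewrite ComplexField.Normc.normc0 expr0n add0r.
apply: ler_rsum_uniq; [|by move=> t; exact: sqr_ge0|exact: ell2P].
exact: (pmap_uniq (@insubK _ _ (subgroup N))).
Qed.

Definition bounded_linear (V W : hilbertType R) (a : V -> W) :=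
  linear a /\ exists2 C, 0 <= C & forall x, `|a x| <= C * `|x|.

Lemma bounded_linear_comp (V1 V2 V3 : hilbertType R) (a : V2 -> V3) (b : V1 -> V2) :
  bounded_linear a -> bounded_linear b -> bounded_linear (a \o b).
Proof.
move=> [la [C C0 aC]] [lb [D D0 bD]]; split=> [c x y|]; first by rewrite /= lb la.
exists (C * D) => [|x]; first exact: mulr_ge0.
by apply: le_trans (aC _) _; rewrite -mulrA ler_wpM2l.
Qed.

Lemma comb_bounded_linear (V : hilbertType R) (U : K -> V -> V) p :
  unitary_rep U -> bounded_linear (comb U p).
Proof.
move=> rU; split; first exact: comb_linear.
by exists (comb_norm p); [exact: comb_norm_ge0|exact: ler_comb].
Qed.

Lemma norm_closure_bounded_linear (V : hilbertType R) (U : K -> V -> V) a :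
  unitary_rep U -> norm_closure (range (comb U)) a -> bounded_linear a.
Proof.
move=> rU Aa; have [p ap] := norm_closure_comb Aa ltr01.
split; first by case: Aa => -[].
exists (1 + comb_norm p); first by rewrite addr_ge0// comb_norm_ge0.
move=> x; rewrite -[a x](subrK (comb U p x)) mulrDl.
by apply: le_trans (ler_normD _ _) _; rewrite lerD// ler_comb.
Qed.

Lemma expectation_bounded_linear a : bounded_linear a ->
  bounded_linear (Defs.expectation N a : ell2 R (subgroup N) -> ell2 R (subgroup N)).
Proof.
move=> [la [C C0 aC]]; split=> [c x y|].
  by rewrite /Defs.expectation ell2_extend_linear la; exact: ell2_eqP.
exists C => // x; apply: le_trans (ell2_comp_norm _ _) _.
by apply: le_trans (aC _) _; rewrite ler_wpM2l// ell2_extend_norm.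
Qed.

Lemma expectation_close (e : R[i]) a b : 0 <= e -> op_close e a b ->
  op_close e (Defs.expectation N a) (Defs.expectation N b).
Proof.
move=> e0 ab x; have -> : Defs.expectation N a x - Defs.expectation N b x =
    ell2_comp (@val_inj _ _ (subgroup N)) (a (ell2_extend x) - b (ell2_extend x)).
  exact: ell2_eqP.
apply: le_trans (ell2_comp_norm _ _) _; apply: le_trans (ab _) _.
by rewrite ler_wpM2l// ell2_extend_norm.
Qed.

End Expectation.

Section InducedIdeal.
Variables (R : realType) (K : groupType) (N : groupClosed K).
Variable J : set (ell2 R (subgroup N) -> ell2 R (subgroup N)).
Hypothesis idealJ : is_ideal (reduced_algebra R (subgroup N)) J.

Local Notation lam := (@lambda R K).
Local Notation E := (Defs.expectation N).

(** J is closed, so a Lipschitz map that sends the group algebra into J sends the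
    reduced algebra into J. *)
Lemma ideal_limit
    (F : (ell2 R K -> ell2 R K) -> ell2 R (subgroup N) -> ell2 R (subgroup N))
    (C : R[i]) a : 0 <= C ->
  (forall e a b, 0 <= e -> op_close e a b -> op_close (e * C) (F a) (F b)) ->
  (forall p, J (F (comb lam p))) ->
  bounded_linear (F a) -> reduced_algebra R K a -> J (F a).
Proof.
move=> C0 Fclose Fp [lF bF] Aa; apply: (ideal_closed idealJ); split.
  exact: linear_bounded_operator.
move=> e e0; pose d : R[i] := e%:C%C / (1 + C).
have d0 : 0 < d by rewrite divr_gt0 ?ltcR// ltr_pwDl.
move: Aa; rewrite reduced_algebraE => {}Aa.
have [p ap] := norm_closure_comb Aa d0.
exists (F (comb lam p)) => //.
apply: op_closeW (Fclose _ _ _ (ltW d0) ap).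
by rewrite /d mulrAC ler_pdivrMr ?ltr_pwDl// ler_pM2l ?ltcR// lerDr.
Qed.

Lemma ideal_scaleD c S T : J S -> J T -> J (fun x => c *: S x + T x).
Proof. exact: (ideal_linear idealJ). Qed.

Lemma ideal_comb_left d p : (forall k, J (E (lam k \o d))) -> J (E (comb lam p \o d)).
Proof.
move=> Jk; elim: p => [|a p ih].
  have -> : E (comb lam [::] \o d) = fun=> 0; last exact: (ideal0 idealJ).
  by rewrite comb_nil; apply/funext => x; exact: ell2_eqP.
have -> : E (comb lam (a :: p) \o d) =
    fun x => a.1 *: E (lam a.2 \o d) x + E (comb lam p \o d) x.
  apply/funext => x; rewrite /Defs.expectation /= comb_cons; exact: ell2_eqP.
exact: ideal_scaleD.
Qed.

Lemma ideal_comb_right d p : linear d -> (forall k, J (E (d \o lam k))) ->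
  J (E (d \o comb lam p)).
Proof.
move=> ld Jk; elim: p => [|a p ih].
  have -> : E (d \o comb lam [::]) = fun=> 0; last exact: (ideal0 idealJ).
  have d0 : d 0 = 0.
    by have := ld (-1) 0 0; rewrite scaler0 addr0 scaleN1r addNr.
  rewrite comb_nil; apply/funext => x.
  by rewrite /Defs.expectation /= d0; exact: ell2_eqP.
have -> : E (d \o comb lam (a :: p)) =
    fun x => a.1 *: E (d \o lam a.2) x + E (d \o comb lam p) x.
  by apply/funext => x; rewrite /Defs.expectation /= comb_cons ld; exact: ell2_eqP.
exact: ideal_scaleD.
Qed.

(** Sums reduce x and y to group elements, limits extend to the reduced algebra,
    first in x with y in the group algebra, then in y. *)
Lemma induced_ideal_generators b : reduced_algebra R K b ->
  (forall k l, J (E (lam k \o b \o lam l))) -> induced_ideal J b.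
Proof.
have rl := lambda_unitary R K.
have bl a : reduced_algebra R K a -> bounded_linear a.
  by rewrite reduced_algebraE; exact: norm_closure_bounded_linear.
move=> Ab Jkl; split=> // x y Ax Ay.
have lb : linear b by case: (bl _ Ab).
have [_ [Cb Cb0 bC]] := bl _ Ab; have [lx [Cx Cx0 xC]] := bl _ Ax.
have Jq q : J (E (x \o b \o comb lam q)).
  have [_ [Cq Cq0 qC]] := comb_bounded_linear q rl.
  apply: (@ideal_limit (fun a => E (a \o b \o comb lam q)) (Cb * Cq)) => //.
  - exact: mulr_ge0.
  - move=> e a a' e0 aa'; apply: expectation_close; first by rewrite !mulr_ge0.
    move=> z; apply: le_trans (aa' _) _; rewrite -!mulrA ler_wpM2l//.
    by apply: le_trans (bC _) _; rewrite ler_wpM2l.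
  - move=> p; apply: (@ideal_comb_left (b \o comb lam q)) => k.
    apply: (@ideal_comb_right (lam k \o b)) => // c u v.
    by rewrite /= lb (urep_linear rl).
  - apply: expectation_bounded_linear; apply: bounded_linear_comp.
      exact: bounded_linear_comp (bl _ Ax) (bl _ Ab).
    exact: comb_bounded_linear.
apply: (@ideal_limit (fun a => E (x \o b \o a)) (Cx * Cb)) => //.
- exact: mulr_ge0.
- move=> e a a' e0 aa'; apply: expectation_close; first by rewrite !mulr_ge0.
  have sub (f : ell2 R K -> ell2 R K) u v : linear f -> f u - f v = f (u - v).
    by move=> lf; rewrite addrC -scaleN1r -lf scaleN1r addrC.
  move=> z /=; rewrite (sub x)// (sub b)//; apply: le_trans (xC _) _.
  rewrite mulrC -mulrA -mulrA; rewrite [leRHS]mulrCA [leLHS]mulrC ler_wpM2l//.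
  by apply: le_trans (bC _) _; rewrite mulrCA ler_wpM2l.
- apply: expectation_bounded_linear; apply: bounded_linear_comp; last exact: bl.
  exact: bounded_linear_comp (bl _ Ax) (bl _ Ab).
Qed.

(** For k, l in K the element k (1 - f) l is k l (1 - f^l).  If k l is in N, its
    expectation is a multiple of that of 1 - f^l by an element of C*_r(N); if not,
    both of its terms lie outside N and its expectation is 0. *)
Lemma induced_ideal_normal (f : K) :
  (forall g, (f ^ g)%g \in N) ->
  (forall g, J (fun x => E (lam 1%g) x - E (lam (f ^ g)%g) x)) ->
  induced_ideal J (comb lam [:: (1, 1%g); (-1, f)]).
Proof.
have rl := lambda_unitary R K.
move=> fN Jf; apply: induced_ideal_generators => [|k l].
  by rewrite reduced_algebraE; exact: comb_in_norm_closure.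
have -> : E (lam k \o comb lam [:: (1, 1%g); (-1, f)] \o lam l) =
    fun x => -1 *: E (lam (k * l * f ^ l)%g) x + E (lam (k * l)%g) x.
  have -> : (k * l * f ^ l = k * (f * l))%g by rewrite -mulgA -conjgC.
  apply/funext => x; rewrite /Defs.expectation /= combB (urep1 rl).
  by rewrite -scaleN1r addrC (urep_linear rl) !(urepM rl); exact: ell2_eqP.
have [klN|klN] := boolP ((k * l)%g \in N); last first.
  rewrite !expectation_lambda0// ?(gpredMr _ (fN l))//.
  by under eq_fun do rewrite scaler0 addr0; exact: (ideal0 idealJ).
pose m : subgroup N := Sub (k * l)%g klN.
have -> : (fun x => -1 *: E (lam (k * l * f ^ l)%g) x + E (lam (k * l)%g) x) =
    lambda R m \o (fun x => E (lam 1%g) x - E (lam (f ^ l)%g) x).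
  have rm := lambda_unitary R (subgroup N).
  apply/funext => x /=; pose n : subgroup N := Sub (f ^ l)%g (fN l).
  have -> : (k * l * f ^ l)%g = val (m * n)%g by rewrite valM !SubK.
  have -> : (k * l)%g = val m by rewrite SubK.
  have -> : (f ^ l)%g = val n by rewrite SubK.
  rewrite -(val1 (subgroup N)) !expectation_lambda (urep1 rm) (urepM rm).
  by rewrite -[in RHS]scaleN1r (urepD rm) (urepZ rm) addrC.
apply: (ideal_mull idealJ) => //.
rewrite reduced_algebraE; have -> : lambda R m = comb (@lambda R _) [:: (1, m)].
  by apply/funext => x; rewrite comb1.
exact/comb_in_norm_closure/lambda_unitary.
Qed.

End InducedIdeal.

(** * The element (h - 1)(1 - f) of the kernel *)

Section NotInduced.
Variables (R : realType) (G : groupType) (H : groupClosed G).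

Local Notation K := (wreath H).
Local Notation lam := (@lambda R K).
Local Notation q0 := (base_coset H).
Local Notation f0 := (Wreath (lamp_at q0) 1%g : K).

(** The element (h - 1)(1 - f0) of the group algebra. *)
Definition stabilizer_element (h : G) : seq (R[i] * K) :=
  comb_mul [:: (1, Wreath 0 h); (-1, 1%g)] [:: (1, 1%g); (-1, f0)].

(** 1 - f0 maps into the line of delta_q0, which h fixes. *)
Lemma lamp_rep_stabilizer_element h : h \in H ->
  comb (@lamp_rep R G H) (stabilizer_element h) = fun=> 0.
Proof.
move=> hH; have rq := @lamp_rep_unitary R G H; apply/funext => w.
rewrite (comb_mulE rq) !combB !(urep1 rq) lamp_rep_lamp_at (urepZ rq) lamp_rep_delta.
rewrite lamp_sign0 scale1r /base_coset coset_actE mulg1.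
have -> : coset H h = coset H 1%g by apply/esym/coset_eqP; rewrite invg1 mul1g.
exact: subrr.
Qed.

Lemma lamp_rep_lamp_neq0 : comb (@lamp_rep R G H) [:: (1, 1%g); (-1, f0)] <> fun=> 0.
Proof.
have rq := @lamp_rep_unitary R G H.
move=> /(congr1 (fun T => T (delta R q0))); rewrite combB (urep1 rq) lamp_rep_lamp_at.
move=> /(congr1 (fun w : ell2 R (coset_space H) => w q0)).
rewrite ell2_scaleE /= eqxx !mulr1.
by move/eqP; rewrite -[X in _ == X]/(0 : R[i]) pnatr_eq0.
Qed.

Lemma conj_lamp (f : lamps H) (g : K) : (Wreath f 1 ^ g)%g \in lamp_group H.
Proof.
rewrite /conjg inE -[wreath_base _]/((wreath_base g)^-1 * (1 * wreath_base g))%g.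
by rewrite mul1g mulVg.
Qed.

(** Multiplying (h - 1)(1 - f0) by g^-1 h^-1 and g leaves 1 - f0^g minus
    z - z', where z and z' are outside N because their components in G are
    conjugate to h^-1. *)
Lemma expectation_stabilizer_element (h : G) (g : K) : h != 1%g ->
  Defs.expectation (lamp_group H)
    (lam (g^-1 * (Wreath 0 h)^-1)%g \o comb lam (stabilizer_element h) \o lam g) =
  fun x => Defs.expectation (lamp_group H) (lam 1%g) x -
           Defs.expectation (lamp_group H) (lam (f0 ^ g)%g) x.
Proof.
move=> h1; have rl := lambda_unitary R K.
pose z := (g^-1 * (Wreath 0 h)^-1 * g : K)%g.
pose z' := (g^-1 * (Wreath 0 h)^-1 * f0 * g : K)%g.
have base_z : wreath_base z != 1%g.
  rewrite -[wreath_base z]/((wreath_base g)^-1 * h^-1 * wreath_base g)%g.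
  by rewrite -mulgA -conjgE conjg_eq1 invg_eq1.
have zN : z \notin lamp_group H by rewrite inE.
have z'N : z' \notin lamp_group H.
  rewrite inE.
  rewrite -[wreath_base z']/((wreath_base g)^-1 * h^-1 * 1 * wreath_base g)%g.
  by rewrite mulg1.
have Ez := expectation_lambda0 R zN; have Ez' := expectation_lambda0 R z'N.
apply/funext => x.
have -> : Defs.expectation (lamp_group H) (lam (g^-1 * (Wreath 0 h)^-1)%g \o
    comb lam (stabilizer_element h) \o lam g) x =
  Defs.expectation (lamp_group H) (lam 1%g) x -
  Defs.expectation (lamp_group H) (lam (f0 ^ g)%g) x -
  (Defs.expectation (lamp_group H) (lam z) x -
   Defs.expectation (lamp_group H) (lam z') x).
  rewrite /Defs.expectation /= (comb_mulE rl) !combB !(urep1 rl).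
  set y := ell2_extend x.
  have B k u v : lam k (u - v) = lam k u - lam k v.
    by rewrite -scaleN1r addrC (urep_linear rl) scaleN1r addrC.
  rewrite !B -!(urepM rl) mulgVK mulVg.
  rewrite -/z -/z' -mulgA -conjgE (urep1 rl).
  exact: ell2_eqP.
by rewrite Ez Ez' subrr subr0.
Qed.

End NotInduced.

Theorem proposition3p7 (R : realType) (G : groupType) (H : groupClosed G)
    (H_amenable : amenable R (subgroup H))
    (H_nontrivial : exists2 h, h \in H & h != 1%g)
    (H_infinite_index : infinite_set [set: coset_space H]) :
  exists2 I : set (ell2 R (wreath H) -> ell2 R (wreath H)),
    is_primitive_ideal (reduced_algebra R (wreath H)) I &
    ~ exists2 J, is_ideal (reduced_algebra R (subgroup (lamp_group H))) J &
        I = induced_ideal J.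
Proof.
have rl := lambda_unitary R (wreath H).
have [rho [rho_rep rhoE]] := weakly_contained_extends rl (@lamp_rep_unitary R G H)
  (lamp_rep_weakly_contained H_amenable).
rewrite -reduced_algebraE in rho_rep.
have inA p : reduced_algebra R (wreath H) (comb (@lambda R (wreath H)) p).
  by rewrite reduced_algebraE; exact: comb_in_norm_closure.
exists [set a | reduced_algebra R (wreath H) a /\ rho a = (fun=> 0)].
  by exists (ell2 R (coset_space H)), rho; split=> //; exact: lamp_rep_irreducible.
move=> [J idealJ IJ]; have [h hH h1] := H_nontrivial.
have Ik p : comb (@lamp_rep R G H) p = (fun=> 0) <->
    induced_ideal J (comb (@lambda R (wreath H)) p).
  by rewrite -IJ /= rhoE; split=> [|[]].
have /Ik[_ Jc] := lamp_rep_stabilizer_element R hH.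
apply: (@lamp_rep_lamp_neq0 R G H); apply/Ik.
apply: induced_ideal_normal => // g; first exact: conj_lamp.
rewrite -(expectation_stabilizer_element R g h1); apply: Jc.
  have -> : forall k, lambda R k = comb (@lambda R (wreath H)) [:: (1, k)].
    by move=> k; apply/funext => x; rewrite comb1.
  exact: inA.
have -> : lambda R g = comb (@lambda R (wreath H)) [:: (1, g)].
  by apply/funext => x; rewrite comb1.
exact: inA.
Qed.
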